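(* Let $\mathbf r=\binom{r_1}{r_2}\in\mathbb Q^2$. For every $(A,\varepsilon)\in\mathrm{Mp}_2(\mathbb Z)$ with $A=\begin{pmatrix}a&b\\c&d\end{pmatrix}\in\Gamma_{\mathbf r}$ and every $\tau\in\mathbb H$, $$\theta_{\mathbf r}(A\cdot\tau)=\psi(A,\varepsilon)^3\chi_{\mathbf r}(A)\varepsilon(\tau)\theta_{\mathbf r}(\tau),$$ where $\chi_{\mathbf r}(A)=e\big(\tfrac12((c-d+1)r_1+(-a+b+1)r_2-cdr_1^2+2(a-1)dr_1r_2-(a-2)br_2^2)\big)$; moreover $\chi_{\mathbf r}$ is a character of $\Gamma_{\mathbf r}$.
   Context: $e(z)=e^{2\pi iz}$; $\mathbb H$ the upper half plane; $A\cdot\tau=\frac{a\tau+b}{c\tau+d}$; $\Gamma_{\mathbf r}=\{A\in\mathrm{SL}_2(\mathbb Z):A\mathbf r-\mathbf r\in\mathbb Z^2\}$. $\theta_{\mathbf r}(\tau)=\sum_{n\in\mathbb Z}e\big(\tfrac12(n+r_2+\tfrac12)^2\tau+(n+r_2+\tfrac12)(-r_1+\tfrac12)\big)$. $\mathrm{Mp}_2(\mathbb Z)$ is the set of pairs $(A,\varepsilon)$ with $A\in\mathrm{SL}_2(\mathbb Z)$ and $\varepsilon$ continuous on $\mathbb H$ with $\varepsilon(\tau)^2=c\tau+d$. With $\eta(\tau)=e(\tau/24)\prod_{k\ge1}(1-e(k\tau))$, $\psi(A,\varepsilon)$ is the constant with $\eta(A\cdot\tau)=\psi(A,\varepsilon)\varepsilon(\tau)\eta(\tau)$.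 *)

(* Defs.v *)
From Stdlib Require Import Reals QArith Qreals ZArith.
From Coquelicot Require Export Coquelicot.
Open Scope R_scope.

Definition cexp (z : C) : C :=
  (RtoC (exp (Re z)) * (RtoC (cos (Im z)) + Ci * RtoC (sin (Im z))))%C.

Definition ee (z : C) : C := cexp (RtoC (2 * PI) * Ci * z)%C.

Definition upper_half (tau : C) : Prop := 0 < Im tau.

Definition limC (u : nat -> C) : C := @lim C_CompleteNormedModule (filtermap u eventually).

Definition sumZ (f : Z -> C) : C :=
  (limC (sum_n (fun n => f (Z.of_nat n))) +
   limC (sum_n (fun n => f (- Z.of_nat n - 1)%Z)))%C.

Definition theta (r1 r2 : Q) (tau : C) : C :=
  sumZ (fun n =>
    let m : R := IZR n + Q2R r2 + / 2 in
    ee (RtoC (/ 2 * m ^ 2) * tau + RtoC (m * (- Q2R r1 + / 2)))%C).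

Fixpoint eta_pprod (tau : C) (N : nat) : C :=
  match N with
  | O => 1%C
  | S n => (eta_pprod tau n * (1 - ee (RtoC (INR (S n)) * tau)))%C
  end.

Definition eta (tau : C) : C :=
  (ee (tau / RtoC 24) * limC (eta_pprod tau))%C.

Definition moeb (a b c d : Z) (tau : C) : C :=
  ((RtoC (IZR a) * tau + RtoC (IZR b)) / (RtoC (IZR c) * tau + RtoC (IZR d)))%C.

Definition inGamma (r1 r2 : Q) (a b c d : Z) : Prop :=
  (a * d - b * c = 1)%Z /\
  (exists k1 : Z, IZR a * Q2R r1 + IZR b * Q2R r2 - Q2R r1 = IZR k1) /\
  (exists k2 : Z, IZR c * Q2R r1 + IZR d * Q2R r2 - Q2R r2 = IZR k2).

Definition is_mp_eps (c d : Z) (eps : C -> C) : Prop :=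
  (forall tau, upper_half tau ->
     filterlim eps (within upper_half (locally tau)) (locally (eps tau))) /\
  (forall tau, upper_half tau ->
     (eps tau * eps tau)%C = (RtoC (IZR c) * tau + RtoC (IZR d))%C).

Definition chi (r1 r2 : Q) (a b c d : Z) : C :=
  let x1 := Q2R r1 in let x2 := Q2R r2 in
  let a' := IZR a in let b' := IZR b in let c' := IZR c in let d' := IZR d in
  ee (RtoC (/ 2 * ((c' - d' + 1) * x1 + (- a' + b' + 1) * x2
                   - c' * d' * x1 ^ 2 + 2 * (a' - 1) * d' * x1 * x2
                   - (a' - 2) * b' * x2 ^ 2))).

(* Main.v *)
Require Import Defs.
From Stdlib Require Import Reals QArith Qreals ZArith.
From Coquelicot Require Import Coquelicot.
From Stdlib Require Import Lra Lia FunctionalExtensionality.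
Open Scope R_scope.

(** Up to an explicit exponential, [theta_r(tau)] is the value at [r2 tau - r1] of Jacobi's function
    [theta(z; tau)], which is entire in [z] and satisfies [theta(z + 1) = - theta(z)] and
    [theta(z + tau) = - e(- tau/2 - z) theta(z)]. An entire function with these two
    quasi-periods is determined up to a factor: its half-integral Fourier coefficients satisfy a
    first-order recursion, and a periodic entire function with zero Fourier coefficients vanishes.
    For [A] in SL2(Z) the function [e(- c z^2 / (2 (c tau + d))) theta(z / (c tau + d); A tau)] has
    the same quasi-periods, hence equals [K theta(z; tau)], and [K] is read off from the
    derivatives at [z = 0]. By Jacobi's formula [theta'(0; tau) = - 2 pi eta(tau)^3], so that
    [K = psi^3 eps], without generators of the modular group or Poisson summation. Jacobi's formula
    is the limit of a finite identity obtained by differentiating the finite triple product.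

    Putting [A^-1 r = r + (p, q)] with integers [p], [q], the exponent of [chi_r(A)] becomes
    [(p q - p - q + r1 q - r2 p) / 2], which makes both the final shift of [z] by [q tau - p] and
    the multiplicativity of [chi_r] a parity count. *)

(** * Complex exponentials *)

(** With [tau' = A tau] and [v = c tau + d] one has [1 / v = a - c tau'] and [tau / v = d tau' - b],
    so dividing by [v] carries the periods 1 and [tau] into the lattice of [tau']. The Gaussian
    factor brings the resulting factors of automorphy back to those of theta(z; tau); what remains
    is a sign, which determinant 1 fixes through the parity of [a c + a - c] and [d b + d - b].
    Theta vanishes at [z = 0], hence the comparison of derivatives there: [K = theta'(0; tau') / (v
    theta'(0; tau)) = psi^3 eps^3 / v], and [eps^2 = v] leaves [psi^3 eps]. The uniqueness argument
    uses integrals over one real period only. Moving the segment by a complex [w] is done by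
    differentiating in the shift parameter, and Bessel's inequality, applied to long runs of equal
    coefficients, replaces any pointwise convergence of Fourier series. *)

Lemma C_ext (z w : C) : Re z = Re w -> Im z = Im w -> z = w.
Proof. destruct z, w; simpl; intros; congruence. Qed.

Lemma cexp_plus (z w : C) : cexp (z + w) = (cexp z * cexp w)%C.
Proof.
  destruct z as [x y], w as [x' y']; apply C_ext; unfold cexp; simpl;
    rewrite exp_plus, cos_plus, sin_plus; ring.
Qed.

Lemma cexp_0 : cexp 0 = 1%C.
Proof. apply C_ext; unfold cexp; simpl; rewrite exp_0, cos_0, sin_0; ring. Qed.

Lemma Cmod_cexp (z : C) : Cmod (cexp z) = exp (Re z).
Proof.
  unfold cexp. rewrite Cmod_mult, Cmod_R, Rabs_pos_eq by (left; apply exp_pos).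
  replace (Cmod (RtoC (cos (Im z)) + Ci * RtoC (sin (Im z)))) with 1; [ring|].
  transitivity (sqrt 1); [symmetry; apply sqrt_1|unfold Cmod; f_equal; simpl].
  pose proof (sin2_cos2 (Im z)) as H; unfold Rsqr in H.
  transitivity (sin (Im z) * sin (Im z) + cos (Im z) * cos (Im z)); [auto|ring].
Qed.

Lemma ee_plus (z w : C) : ee (z + w) = (ee z * ee w)%C.
Proof. unfold ee; rewrite <- cexp_plus; f_equal; ring. Qed.

Lemma ee_0 : ee 0 = 1%C.
Proof. unfold ee; rewrite Cmult_0_r; apply cexp_0. Qed.

Lemma ee_opp (z : C) : (ee (- z) * ee z)%C = 1%C.
Proof. rewrite <- ee_plus, <- ee_0; f_equal; ring. Qed.

Lemma Cmod_ee (z : C) : Cmod (ee z) = exp (- (2 * PI * Im z)).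
Proof. unfold ee; rewrite Cmod_cexp; f_equal; destruct z; simpl; ring. Qed.

Lemma ee_neq_0 (z : C) : ee z <> 0%C.
Proof. apply Cmod_gt_0; rewrite Cmod_ee; apply exp_pos. Qed.

Lemma ee_real (x : R) : ee (RtoC x) = (cos (2 * PI * x), sin (2 * PI * x)).
Proof.
  apply C_ext; unfold ee, cexp; simpl;
    replace ((2 * PI * 0 - 0 * 1) * x - (2 * PI * 1 + 0 * 0) * 0) with 0 by ring;
    replace ((2 * PI * 0 - 0 * 1) * 0 + (2 * PI * 1 + 0 * 0) * x) with (2 * PI * x) by ring;
    rewrite exp_0; ring.
Qed.

Lemma ee_nat (n : nat) : ee (RtoC (INR n)) = 1%C.
Proof.
  rewrite ee_real. apply C_ext; simpl.
  - rewrite <- cos_0, <- (cos_period 0 n); f_equal; ring.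
  - rewrite <- sin_0, <- (sin_period 0 n); f_equal; ring.
Qed.

Lemma ee_Z (n : Z) : ee (RtoC (IZR n)) = 1%C.
Proof.
  destruct (Z_le_gt_dec 0 n) as [H|H].
  - rewrite <- (Z2Nat.id n H), <- INR_IZR_INZ; apply ee_nat.
  - pose proof (ee_opp (RtoC (IZR n))) as E.
    replace (- RtoC (IZR n))%C with (RtoC (INR (Z.to_nat (- n)))) in E.
    + rewrite ee_nat in E. rewrite <- E; ring.
    + rewrite INR_IZR_INZ, Z2Nat.id by lia. rewrite opp_IZR, RtoC_opp; reflexivity.
Qed.

Lemma ee_plus_Z (z : C) (n : Z) : ee (z + RtoC (IZR n)) = ee z.
Proof. rewrite ee_plus, ee_Z; ring. Qed.

Lemma ee_eq_mod_Z (z w : C) (n : Z) : (z = w + RtoC (IZR n))%C -> ee z = ee w.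
Proof. intros ->; apply ee_plus_Z. Qed.

Lemma ee_half : ee (RtoC (/ 2)) = (- (1))%C.
Proof.
  rewrite ee_real; replace (2 * PI * / 2) with PI by field.
  rewrite cos_PI, sin_PI; apply C_ext; simpl; ring.
Qed.

Lemma ee_nat_mul (n : nat) (z : C) : ee (RtoC (INR n) * z) = (ee z ^ n)%C.
Proof.
  induction n as [|n IH].
  - simpl; rewrite Cmult_0_l; apply ee_0.
  - rewrite S_INR, RtoC_plus. replace ((INR n + 1) * z)%C with (z + INR n * z)%C by ring.
    rewrite ee_plus, IH; reflexivity.
Qed.

(** * Taylor remainders of the exponential *)

Lemma Rabs_exp_sub_1 (x : R) : Rabs (exp x - 1) <= Rabs x * exp (Rabs x).
Proof.
  destruct (MVT_abs exp exp 0 x) as [c [Hc Hr]].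
  - intros; apply derivable_pt_lim_exp.
  - rewrite exp_0, !Rminus_0_r in Hc. rewrite Hc, Rmult_comm.
    apply Rmult_le_compat_l; [apply Rabs_pos|].
    rewrite Rabs_pos_eq by (left; apply exp_pos).
    assert (c <= Rabs x).
    { unfold Rmin, Rmax in Hr; destruct (Rle_dec 0 x); unfold Rabs; destruct (Rcase_abs x); lra. }
    destruct H; [left; apply exp_increasing; auto|right; f_equal; auto].
Qed.

Lemma Rabs_exp_sub_1_sub (x : R) : Rabs (exp x - 1 - x) <= Rabs x ^ 2 * exp (Rabs x).
Proof.
  destruct (MVT_abs (fun x => exp x - x) (fun x => exp x - 1) 0 x) as [c [Hc Hr]].
  - intros; apply derivable_pt_lim_minus; [apply derivable_pt_lim_exp|apply derivable_pt_lim_id].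
  - rewrite exp_0, !Rminus_0_r in Hc. replace (exp x - 1 - x) with (exp x - x - 1) by ring.
    rewrite Hc. pose proof (Rabs_exp_sub_1 c) as H1.
    assert (Hcx : Rabs c <= Rabs x).
    { unfold Rmin, Rmax in Hr; destruct (Rle_dec 0 x); unfold Rabs;
        destruct (Rcase_abs x), (Rcase_abs c); lra. }
    assert (exp (Rabs c) <= exp (Rabs x)).
    { destruct Hcx; [left; apply exp_increasing; auto|right; f_equal; auto]. }
    pose proof (Rabs_pos x); pose proof (Rabs_pos c); pose proof (exp_pos (Rabs c)).
    assert (Rabs c * exp (Rabs c) <= Rabs x * exp (Rabs x)) by nra. nra.
Qed.

Lemma Rabs_cos_sub_1 (y : R) : Rabs (cos y - 1) <= Rabs y.
Proof.
  destruct (MVT_abs cos (fun x => - sin x) 0 y) as [c [Hc Hr]].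
  - intros; apply derivable_pt_lim_cos.
  - rewrite cos_0, !Rminus_0_r in Hc. rewrite Hc, Rabs_Ropp.
    pose proof (Rabs_pos y).
    assert (Rabs (sin c) <= 1) by (apply Rabs_le; apply SIN_bound). nra.
Qed.

Lemma Rabs_sin (y : R) : Rabs (sin y) <= Rabs y.
Proof.
  destruct (MVT_abs sin cos 0 y) as [c [Hc Hr]].
  - intros; apply derivable_pt_lim_sin.
  - rewrite sin_0, !Rminus_0_r in Hc. rewrite Hc.
    pose proof (Rabs_pos y).
    assert (Rabs (cos c) <= 1) by (apply Rabs_le; apply COS_bound). nra.
Qed.

Lemma Rabs_cos_sub_1_sqr (y : R) : Rabs (cos y - 1) <= Rabs y ^ 2.
Proof.
  destruct (MVT_abs cos (fun x => - sin x) 0 y) as [c [Hc Hr]].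
  - intros; apply derivable_pt_lim_cos.
  - rewrite cos_0, !Rminus_0_r in Hc. rewrite Hc, Rabs_Ropp.
    assert (Hcx : Rabs c <= Rabs y).
    { unfold Rmin, Rmax in Hr; destruct (Rle_dec 0 y); unfold Rabs;
        destruct (Rcase_abs y), (Rcase_abs c); lra. }
    pose proof (Rabs_pos y). pose proof (Rabs_sin c). nra.
Qed.

Lemma Rabs_sin_sub (y : R) : Rabs (sin y - y) <= Rabs y ^ 2.
Proof.
  destruct (MVT_abs (fun x => sin x - x) (fun x => cos x - 1) 0 y) as [c [Hc Hr]].
  - intros; apply derivable_pt_lim_minus; [apply derivable_pt_lim_sin|apply derivable_pt_lim_id].
  - rewrite sin_0, !Rminus_0_r in Hc. rewrite Hc.
    assert (Hcx : Rabs c <= Rabs y).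
    { unfold Rmin, Rmax in Hr; destruct (Rle_dec 0 y); unfold Rabs;
        destruct (Rcase_abs y), (Rcase_abs c); lra. }
    pose proof (Rabs_pos y). pose proof (Rabs_cos_sub_1 c). nra.
Qed.

Lemma Cmod_le_Re_Im (z : C) : Cmod z <= Rabs (Re z) + Rabs (Im z).
Proof.
  replace z with (RtoC (Re z) + Ci * RtoC (Im z))%C at 1
    by (apply C_ext; simpl; ring).
  eapply Rle_trans; [apply Cmod_triangle|].
  rewrite Cmod_mult, !Cmod_R. replace (Cmod Ci) with 1; [lra|].
  unfold Cmod; simpl. replace (0 * (0 * 1) + 1 * (1 * 1)) with 1 by ring.
  symmetry; apply sqrt_1.
Qed.

Lemma Rabs_Re_le (z : C) : Rabs (Re z) <= Cmod z.
Proof. eapply Rle_trans; [|apply Rmax_Cmod]; apply Rmax_l. Qed.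

Lemma Rabs_Im_le (z : C) : Rabs (Im z) <= Cmod z.
Proof. eapply Rle_trans; [|apply Rmax_Cmod]; apply Rmax_r. Qed.

Lemma exp_le (x y : R) : x <= y -> exp x <= exp y.
Proof. intros [H|H]; [left; apply exp_increasing; auto|right; f_equal; auto]. Qed.

(** With [m = Cmod z], the real and imaginary parts of the remainder are each at most [2 m^2 exp m];
    the constant 8 leaves slack. The bound serves both the chain rule for [cexp] and the termwise
    differentiation of the theta series. *)
Lemma Cmod_cexp_sub (z : C) : Cmod (cexp z - 1 - z) <= 8 * Cmod z ^ 2 * exp (Cmod z).
Proof.
  eapply Rle_trans; [apply Cmod_le_Re_Im|].
  pose proof (Rabs_Re_le z) as Hx; pose proof (Rabs_Im_le z) as Hy.
  destruct z as [x y]; simpl in Hx, Hy. set (m := Cmod (x, y)) in *.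
  pose proof (Rabs_pos x); pose proof (Rabs_pos y).
  assert (He : exp (Rabs x) <= exp m) by (apply exp_le; auto).
  assert (He1 : 1 <= exp m) by (rewrite <- exp_0; apply exp_le; lra).
  assert (Hex : exp x <= exp m) by (apply exp_le; pose proof (Rle_abs x); lra).
  pose proof (exp_pos x).
  unfold cexp; simpl.
  replace (exp x * (cos y + (0 * sin y - 1 * 0)) - 0 * (0 + (0 * 0 + 1 * sin y)) + - (1) + - x)
    with ((exp x - 1 - x) + exp x * (cos y - 1)) by ring.
  replace (exp x * (0 + (0 * 0 + 1 * sin y)) + 0 * (cos y + (0 * sin y - 1 * 0)) + - 0 + - y)
    with (exp x * (sin y - y) + y * (exp x - 1)) by ring.
  assert (Rabs (exp x - 1 - x + exp x * (cos y - 1)) <= 2 * m ^ 2 * exp m).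
  { eapply Rle_trans; [apply Rabs_triang|].
    rewrite Rabs_mult, (Rabs_pos_eq (exp x)) by lra.
    pose proof (Rabs_exp_sub_1_sub x). pose proof (Rabs_cos_sub_1_sqr y).
    assert (Rabs x ^ 2 * exp (Rabs x) <= m ^ 2 * exp m).
    { apply Rmult_le_compat; try nra. left; apply exp_pos. }
    assert (exp x * Rabs (cos y - 1) <= exp m * m ^ 2).
    { apply Rmult_le_compat; try nra. apply Rabs_pos. }
    lra. }
  assert (Rabs (exp x * (sin y - y) + y * (exp x - 1)) <= 2 * m ^ 2 * exp m).
  { eapply Rle_trans; [apply Rabs_triang|].
    rewrite !Rabs_mult, (Rabs_pos_eq (exp x)) by lra.
    pose proof (Rabs_exp_sub_1 x). pose proof (Rabs_sin_sub y).
    assert (exp x * Rabs (sin y - y) <= exp m * m ^ 2).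
    { apply Rmult_le_compat; try nra. apply Rabs_pos. }
    assert (Rabs x * exp (Rabs x) <= m * exp m).
    { apply Rmult_le_compat; try nra. left; apply exp_pos. }
    assert (Rabs y * Rabs (exp x - 1) <= m * (m * exp m)).
    { apply Rmult_le_compat; try nra. apply Rabs_pos. }
    nra. }
  assert (0 <= m ^ 2 * exp m) by nra. lra.
Qed.

(** * Complex differentiability *)

(* [F] is entire with derivative [F'], in the form of a second-order remainder bound that is
   uniform on discs; this form passes to integrals and to dominated series. *)
Definition cdiff (F F' : C -> C) : Prop :=
  forall r : R, exists M : R, forall z h : C, Cmod z <= r -> Cmod h <= r ->
    Cmod (F z) <= M /\ Cmod (F' z) <= M /\
    Cmod (F (z + h) - F z - h * F' z)%C <= M * Cmod h ^ 2.

Lemma cdiff_ext (F G F' G' : C -> C) :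
  (forall z, F z = G z) -> (forall z, F' z = G' z) -> cdiff F F' -> cdiff G G'.
Proof.
  intros H H' D R; destruct (D R) as [M HM]; exists M; intros z h Hz Hh.
  rewrite <- !H, <- H'; auto.
Qed.

Lemma cdiff_const (c : C) : cdiff (fun _ => c) (fun _ => 0%C).
Proof.
  intros R; exists (Cmod c); intros z h _ _; rewrite Cmod_0.
  replace (c - c - h * 0)%C with (RtoC 0) by ring. rewrite Cmod_0.
  pose proof (Cmod_ge_0 c); pose proof (Cmod_ge_0 h). repeat split; nra.
Qed.

Lemma cdiff_id : cdiff (fun z => z) (fun _ => 1%C).
Proof.
  intros R; exists (Rmax R 1); intros z h Hz _; rewrite Cmod_1.
  replace (z + h - z - h * 1)%C with (RtoC 0) by ring. rewrite Cmod_0.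
  pose proof (Rmax_l R 1); pose proof (Rmax_r R 1); pose proof (Cmod_ge_0 h).
  repeat split; nra.
Qed.

Lemma cdiff_plus (F G F' G' : C -> C) : cdiff F F' -> cdiff G G' ->
  cdiff (fun z => F z + G z)%C (fun z => F' z + G' z)%C.
Proof.
  intros DF DG R; destruct (DF R) as [M HM], (DG R) as [N HN].
  exists (M + N); intros z h Hz Hh.
  destruct (HM z h Hz Hh) as (A1 & A2 & A3), (HN z h Hz Hh) as (B1 & B2 & B3).
  repeat split; try (eapply Rle_trans; [apply Cmod_triangle|lra]).
  replace (F (z + h) + G (z + h) - (F z + G z) - h * (F' z + G' z))%C
    with ((F (z + h) - F z - h * F' z) + (G (z + h) - G z - h * G' z))%C by ring.
  eapply Rle_trans; [apply Cmod_triangle|lra].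
Qed.

Lemma Cmod_mult_le (z w : C) (a b : R) :
  Cmod z <= a -> Cmod w <= b -> Cmod (z * w) <= a * b.
Proof. intros; rewrite Cmod_mult; apply Rmult_le_compat; auto; apply Cmod_ge_0. Qed.

Lemma Cmod_plus_le (z w : C) (a b : R) :
  Cmod z <= a -> Cmod w <= b -> Cmod (z + w) <= a + b.
Proof. intros; eapply Rle_trans; [apply Cmod_triangle|lra]. Qed.

(** The Lipschitz bound contained in the quadratic remainder. It controls the cross term of the
    product rule and the inner increment of the chain rule. *)
Lemma cdiff_increment (F F' : C -> C) (r M : R) (z h : C) :
  Cmod h <= r -> Cmod (F' z) <= M ->
  Cmod (F (z + h) - F z - h * F' z)%C <= M * Cmod h ^ 2 ->
  Cmod (F (z + h) - F z)%C <= M * (r + 1) * Cmod h.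
Proof.
  intros H1 H2 H3.
  replace (F (z + h) - F z)%C with ((F (z + h) - F z - h * F' z) + h * F' z)%C by ring.
  eapply Rle_trans; [apply Cmod_plus_le; [exact H3|apply Cmod_mult_le; [apply Rle_refl|exact H2]]|].
  pose proof (Cmod_ge_0 h); pose proof (Cmod_ge_0 (F' z)).
  assert (0 <= M * Cmod h) by nra. nra.
Qed.

Lemma cdiff_mult (F G F' G' : C -> C) : cdiff F F' -> cdiff G G' ->
  cdiff (fun z => F z * G z)%C (fun z => F' z * G z + F z * G' z)%C.
Proof.
  (* Doubling the radius keeps [z + h] in the disc, so that [M] also bounds [F (z + h)]. *)
  intros DF DG R; destruct (DF (R + R)) as [M HM], (DG (R + R)) as [N HN].
  exists (M * N * (R + 3)); intros z h Hz Hh.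
  assert (P := Cmod_ge_0 z). assert (Ph := Cmod_ge_0 h).
  destruct (HM z h) as (A1 & A2 & A3), (HN z h) as (B1 & B2 & B3); try lra.
  destruct (HM (z + h)%C h) as (A4 & _); try lra.
  { eapply Rle_trans; [apply Cmod_triangle|lra]. }
  assert (I := cdiff_increment F F' R M z h Hh A2 A3).
  pose proof (Cmod_ge_0 (F z)); pose proof (Cmod_ge_0 (G z)).
  assert (0 <= M * N) by nra.
  split; [|split].
  - eapply Rle_trans; [apply Cmod_mult_le; eassumption|nra].
  - eapply Rle_trans; [apply Cmod_plus_le; apply Cmod_mult_le; eassumption|nra].
  - replace (F (z + h) * G (z + h) - F z * G z - h * (F' z * G z + F z * G' z))%C
      with (F (z + h) * (G (z + h) - G z - h * G' z) + (F (z + h) - F z - h * F' z) * G z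
            + h * (G' z * (F (z + h) - F z)))%C by ring.
    eapply Rle_trans.
    { apply Cmod_plus_le; [apply Cmod_plus_le; apply Cmod_mult_le; eassumption|].
      apply Cmod_mult_le; [apply Rle_refl|apply Cmod_mult_le; eassumption]. }
    right; ring.
Qed.

Lemma cdiff_scal (c : C) (F F' : C -> C) : cdiff F F' ->
  cdiff (fun z => c * F z)%C (fun z => c * F' z)%C.
Proof.
  intros D. eapply cdiff_ext; [| |apply (cdiff_mult _ _ _ _ (cdiff_const c) D)];
    intros z; simpl; ring.
Qed.

Lemma cdiff_translate (w : C) (F F' : C -> C) : cdiff F F' ->
  cdiff (fun z => F (z + w))%C (fun z => F' (z + w))%C.
Proof.
  intros D R; destruct (D (R + Cmod w)) as [M HM]; exists M; intros z h Hz Hh.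
  pose proof (Cmod_ge_0 w).
  destruct (HM (z + w)%C h) as (A1 & A2 & A3); [|lra|].
  { eapply Rle_trans; [apply Cmod_triangle|lra]. }
  replace (z + h + w)%C with (z + w + h)%C by ring. auto.
Qed.

Lemma cdiff_dilate (a : C) (F F' : C -> C) : cdiff F F' ->
  cdiff (fun z => F (a * z))%C (fun z => a * F' (a * z))%C.
Proof.
  intros D R; destruct (D (Cmod a * R)) as [M HM].
  exists (M * (1 + Cmod a + Cmod a ^ 2)); intros z h Hz Hh.
  pose proof (Cmod_ge_0 a).
  destruct (HM (a * z)%C (a * h)%C) as (A1 & A2 & A3);
    try (apply Cmod_mult_le; [apply Rle_refl|assumption]).
  pose proof (Cmod_ge_0 (F (a * z)%C)).
  split; [|split].
  - nra.
  - rewrite Cmod_mult; nra.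
  - replace (a * (z + h))%C with (a * z + a * h)%C by ring.
    replace (h * (a * F' (a * z)))%C with (a * h * F' (a * z))%C by ring.
    eapply Rle_trans; [exact A3|]. rewrite Cmod_mult.
    pose proof (Cmod_ge_0 h). rewrite Rpow_mult_distr, <- Rmult_assoc.
    apply Rmult_le_compat_r; [nra|]. apply Rmult_le_compat_l; nra.
Qed.

Lemma cdiff_cexp (F F' : C -> C) : cdiff F F' ->
  cdiff (fun z => cexp (F z)) (fun z => F' z * cexp (F z))%C.
Proof.
  intros D R; destruct (D R) as [M HM].
  set (L := M * (R + 1)).
  exists (exp M * (1 + M + 8 * L ^ 2 * exp (L * R))); intros z h Hz Hh.
  destruct (HM z h Hz Hh) as (A1 & A2 & A3).
  assert (I := cdiff_increment F F' R M z h Hh A2 A3). fold L in I.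
  pose proof (Cmod_ge_0 z); pose proof (Cmod_ge_0 h); pose proof (Cmod_ge_0 (F z)).
  assert (PL : 0 <= L) by (unfold L; nra).
  assert (PE := exp_pos (L * R)). assert (PM := exp_pos M).
  assert (E : Cmod (cexp (F z)) <= exp M).
  { rewrite Cmod_cexp; apply exp_le. eapply Rle_trans; [apply Rle_abs|].
    eapply Rle_trans; [apply Rabs_Re_le|assumption]. }
  assert (0 <= 8 * L ^ 2 * exp (L * R)) by nra.
  split; [|split].
  - nra.
  - eapply Rle_trans; [apply Cmod_mult_le; eassumption|nra].
  - set (d := (F (z + h) - F z)%C) in *.
    replace (F (z + h))%C with (F z + d)%C by (unfold d; ring). rewrite cexp_plus.
    replace (cexp (F z) * cexp d - cexp (F z) - h * (F' z * cexp (F z)))%C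
      with (cexp (F z) * ((cexp d - 1 - d) + (d - h * F' z)))%C by ring.
    assert (Q : Cmod (cexp d - 1 - d) <= 8 * L ^ 2 * exp (L * R) * Cmod h ^ 2).
    { eapply Rle_trans; [apply Cmod_cexp_sub|].
      assert (exp (Cmod d) <= exp (L * R)) by (apply exp_le; nra).
      assert (Cmod d ^ 2 <= (L * Cmod h) ^ 2).
      { apply pow_incr; split; [apply Cmod_ge_0|assumption]. }
      pose proof (exp_pos (Cmod d)). assert (0 <= Cmod d ^ 2) by apply pow2_ge_0.
      replace (8 * L ^ 2 * exp (L * R) * Cmod h ^ 2)
        with (8 * ((L * Cmod h) ^ 2 * exp (L * R))) by ring.
      rewrite Rmult_assoc. apply Rmult_le_compat_l; [lra|].
      apply Rmult_le_compat; lra. }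
    eapply Rle_trans.
    { apply Cmod_mult_le; [exact E|apply Cmod_plus_le; [exact Q|exact A3]]. }
    assert (0 <= Cmod h ^ 2) by apply pow2_ge_0. 
    replace (exp M * (1 + M + 8 * L ^ 2 * exp (L * R)) * Cmod h ^ 2)
      with (exp M * (Cmod h ^ 2 + M * Cmod h ^ 2 + 8 * L ^ 2 * exp (L * R) * Cmod h ^ 2)) by ring.
    apply Rmult_le_compat_l; lra.
Qed.

Lemma cdiff_ee (F F' : C -> C) : cdiff F F' ->
  cdiff (fun z => ee (F z)) (fun z => RtoC (2 * PI) * Ci * F' z * ee (F z))%C.
Proof. intros D; apply (cdiff_cexp _ _ (cdiff_scal (RtoC (2 * PI) * Ci)%C _ _ D)). Qed.

(** Adding the remainder at [z] with step [h] to the one at [z + h] with step [- h] cancels the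
    values of [F] and leaves [h (F' (z + h) - F' z)]. This makes [F'] continuous, hence
    integrable. *)
Lemma cdiff_lipschitz (F F' : C -> C) : cdiff F F' -> forall r, exists M,
  forall z h, Cmod z <= r -> Cmod h <= r -> Cmod (F' (z + h) - F' z)%C <= M * Cmod h.
Proof.
  intros D R; destruct (D (R + R)) as [M HM]; exists (2 * M); intros z h Hz Hh.
  pose proof (Cmod_ge_0 z); pose proof (Cmod_ge_0 h).
  destruct (HM z h) as (A1 & A2 & A3); try lra.
  destruct (HM (z + h)%C (- h)%C) as (B1 & B2 & B3).
  { eapply Rle_trans; [apply Cmod_triangle|lra]. }
  { rewrite Cmod_opp; lra. }
  replace (z + h + - h)%C with z in B3 by ring. rewrite Cmod_opp in B3.
  assert (E : Cmod (h * (F' (z + h) - F' z))%C <= 2 * M * Cmod h ^ 2).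
  { replace (h * (F' (z + h) - F' z))%C
      with ((F z - F (z + h) - - h * F' (z + h)) + (F (z + h) - F z - h * F' z))%C by ring.
    eapply Rle_trans; [apply Cmod_plus_le; eassumption|lra]. }
  rewrite Cmod_mult in E.
  destruct (Req_dec (Cmod h) 0) as [Z0|Z0].
  - apply Cmod_eq_0 in Z0; subst h. rewrite Cplus_0_r.
    replace (F' z - F' z)%C with (RtoC 0) by ring. rewrite Cmod_0; lra.
  - apply Rmult_le_reg_l with (Cmod h); [lra|]. lra.
Qed.

(** * Integrals over a period *)

Lemma is_derive_of_quadratic_bound (f : R -> R) (x l M : R) :
  (forall h, Rabs h <= 1 -> Rabs (f (x + h) - f x - h * l) <= M * Rabs h ^ 2) ->
  is_derive f x l.
Proof.
  intros H; apply is_derive_Reals; intros eps Heps.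
  assert (P : 0 < Rabs M + 1) by (pose proof (Rabs_pos M); lra).
  assert (Q : 0 < Rmin 1 (eps / (Rabs M + 1))).
  { apply Rmin_pos; [lra|]. apply Rdiv_lt_0_compat; lra. }
  exists (mkposreal _ Q); intros h Hh Hd; simpl in Hd.
  assert (D1 := Rlt_le_trans _ _ _ Hd (Rmin_l _ _)).
  assert (D2 := Rlt_le_trans _ _ _ Hd (Rmin_r _ _)).
  assert (Ph : 0 < Rabs h) by (apply Rabs_pos_lt; auto).
  assert (B := H h (Rlt_le _ _ D1)).
  replace ((f (x + h) - f x) / h - l) with ((f (x + h) - f x - h * l) / h) by (field; auto).
  unfold Rdiv; rewrite Rabs_mult, Rabs_inv by auto.
  apply Rmult_lt_reg_r with (Rabs h); auto.
  rewrite Rmult_assoc, Rinv_l, Rmult_1_r by lra.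
  eapply Rle_lt_trans; [exact B|].
  assert (E : Rabs h * (Rabs M + 1) < eps).
  { apply Rmult_lt_reg_r with (/ (Rabs M + 1)); [apply Rinv_0_lt_compat; auto|].
    rewrite Rmult_assoc, Rinv_r by lra. unfold Rdiv in D2; lra. }
  pose proof (Rle_abs M). nra.
Qed.

Lemma continuous_of_linear_bound (f : R -> R) (x M : R) :
  (forall h, Rabs h <= 1 -> Rabs (f (x + h) - f x) <= M * Rabs h) -> continuous f x.
Proof.
  intros H; apply continuity_pt_filterlim; intros eps Heps.
  assert (P : 0 < Rabs M + 1) by (pose proof (Rabs_pos M); lra).
  exists (Rmin 1 (eps / (Rabs M + 1))); split.
  { apply Rmin_pos; [lra|]. apply Rdiv_lt_0_compat; lra. }
  intros y [_ Hd]; simpl in *; unfold R_dist in *.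
  assert (D1 := Rlt_le_trans _ _ _ Hd (Rmin_l _ _)).
  assert (D2 := Rlt_le_trans _ _ _ Hd (Rmin_r _ _)).
  assert (B := H (y - x) (Rlt_le _ _ D1)).
  replace (x + (y - x)) with y in B by ring.
  eapply Rle_lt_trans; [exact B|].
  assert (E : Rabs (y - x) * (Rabs M + 1) < eps).
  { apply Rmult_lt_reg_r with (/ (Rabs M + 1)); [apply Rinv_0_lt_compat; auto|].
    rewrite Rmult_assoc, Rinv_r by lra. unfold Rdiv in D2; lra. }
  pose proof (Rle_abs M); pose proof (Rabs_pos (y - x)). nra.
Qed.

(** Continuity is asked on the closed period only, so that a quotient by [(e(x) - 1) / x], whose
    zeros are the nonzero integers, qualifies. *)
Definition ccont (F : R -> C) : Prop :=
  forall x, Rabs x <= / 2 ->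
    continuous (fun t => Re (F t)) x /\ continuous (fun t => Im (F t)) x.

(** The period is centred so that [e(x) = 1] has the single solution 0 in it, an interior point. *)
Definition Cint (F : R -> C) : C :=
  (RInt (fun x => Re (F x)) (- / 2) (/ 2), RInt (fun x => Im (F x)) (- / 2) (/ 2)).

Lemma Rabs_le_half (x : R) : Rmin (- / 2) (/ 2) <= x <= Rmax (- / 2) (/ 2) -> Rabs x <= / 2.
Proof. rewrite Rmin_left, Rmax_right by lra; intros; apply Rabs_le; lra. Qed.

Lemma ccont_ex_RInt (F : R -> C) : ccont F ->
  ex_RInt (fun x => Re (F x)) (- / 2) (/ 2) /\ ex_RInt (fun x => Im (F x)) (- / 2) (/ 2).
Proof.
  intros H; split; apply (@ex_RInt_continuous R_CompleteNormedModule);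
    intros x Hx; apply H, Rabs_le_half, Hx.
Qed.

Lemma continuous_const_R (c x : R) : continuous (fun _ : R => c) x.
Proof. apply (continuous_const (V := R_UniformSpace)). Qed.

Lemma ccont_const (c : C) : ccont (fun _ => c).
Proof. intros x _; split; apply continuous_const_R. Qed.

Lemma ccont_mult (F G : R -> C) : ccont F -> ccont G -> ccont (fun x => F x * G x)%C.
Proof.
  intros HF HG x Hx; destruct (HF x Hx), (HG x Hx); split.
  - apply (continuous_minus (V := R_NormedModule)
      (fun t => Re (F t) * Re (G t)) (fun t => Im (F t) * Im (G t)));
      apply (continuous_mult (K := R_AbsRing)); auto.
  - apply (continuous_plus (V := R_NormedModule)
      (fun t => Re (F t) * Im (G t)) (fun t => Im (F t) * Re (G t)));
      apply (continuous_mult (K := R_AbsRing)); auto.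
Qed.

Lemma ccont_scal (c : C) (F : R -> C) : ccont F -> ccont (fun x => c * F x)%C.
Proof. apply ccont_mult, ccont_const. Qed.

Lemma ccont_minus (F G : R -> C) : ccont F -> ccont G -> ccont (fun x => F x - G x)%C.
Proof.
  intros HF HG x Hx; destruct (HF x Hx), (HG x Hx); split.
  - apply (continuous_minus (V := R_NormedModule) (fun t => Re (F t)) (fun t => Re (G t))); auto.
  - apply (continuous_minus (V := R_NormedModule) (fun t => Im (F t)) (fun t => Im (G t))); auto.
Qed.

Lemma Cint_ext (F G : R -> C) : (forall x, Rabs x <= / 2 -> F x = G x) -> Cint F = Cint G.
Proof.
  intros H; unfold Cint; f_equal; apply RInt_ext; intros x Hx; rewrite H; auto;
    apply Rabs_le_half; lra.
Qed.

Lemma Cint_plus (F G : R -> C) : ccont F -> ccont G ->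
  Cint (fun x => F x + G x)%C = (Cint F + Cint G)%C.
Proof.
  intros HF HG; apply ccont_ex_RInt in HF as [], HG as [].
  apply C_ext; simpl; apply (RInt_plus (V := R_CompleteNormedModule)); auto.
Qed.

Lemma Cint_minus (F G : R -> C) : ccont F -> ccont G ->
  Cint (fun x => F x - G x)%C = (Cint F - Cint G)%C.
Proof.
  intros HF HG; apply ccont_ex_RInt in HF as [], HG as [].
  apply C_ext; simpl; apply (RInt_minus (V := R_CompleteNormedModule)); auto.
Qed.

Lemma RInt_lin_comb (f g : R -> R) (p q : R) :
  ex_RInt f (- / 2) (/ 2) -> ex_RInt g (- / 2) (/ 2) ->
  RInt (fun x => p * f x + q * g x) (- / 2) (/ 2)
  = p * RInt f (- / 2) (/ 2) + q * RInt g (- / 2) (/ 2).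
Proof.
  intros Hf Hg. apply is_RInt_unique.
  apply (is_RInt_plus (V := R_NormedModule) (fun x => p * f x) (fun x => q * g x));
    apply (is_RInt_scal (V := R_NormedModule)); apply (RInt_correct (V := R_CompleteNormedModule)); auto.
Qed.

Lemma Cint_scal (c : C) (F : R -> C) : ccont F -> Cint (fun x => c * F x)%C = (c * Cint F)%C.
Proof.
  intros HF; apply ccont_ex_RInt in HF as [H1 H2]. destruct c as [p q].
  apply C_ext; simpl.
  - transitivity (p * RInt (fun x => Re (F x)) (- / 2) (/ 2)
                  + - q * RInt (fun x => Im (F x)) (- / 2) (/ 2)); [|ring].
    rewrite <- RInt_lin_comb by auto.
    apply RInt_ext; intros x _; apply Rminus_diag_uniq; unfold Re, Im; simpl; ring.
  - transitivity (p * RInt (fun x => Im (F x)) (- / 2) (/ 2)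
                  + q * RInt (fun x => Re (F x)) (- / 2) (/ 2)); [|ring].
    rewrite <- RInt_lin_comb by auto.
    apply RInt_ext; intros x _; apply Rminus_diag_uniq; unfold Re, Im; simpl; ring.
Qed.

Lemma Cint_const (c : C) : Cint (fun _ => c) = c.
Proof.
  apply C_ext; simpl; rewrite RInt_const; unfold scal; simpl; unfold mult; simpl; field.
Qed.

Lemma Cmod_Cint_le (F : R -> C) (M : R) : ccont F ->
  (forall x, Rabs x <= / 2 -> Cmod (F x) <= M) -> Cmod (Cint F) <= 2 * M.
Proof.
  intros HF HM; apply ccont_ex_RInt in HF as [H1 H2].
  eapply Rle_trans; [apply Cmod_le_Re_Im|]; simpl.
  assert (Rabs (RInt (fun x => Re (F x)) (- / 2) (/ 2)) <= (/ 2 - - / 2) * M).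
  { apply abs_RInt_le_const; [lra|auto|]. intros t Ht.
    eapply Rle_trans; [apply Rabs_Re_le|]; apply HM, Rabs_le; auto. }
  assert (Rabs (RInt (fun x => Im (F x)) (- / 2) (/ 2)) <= (/ 2 - - / 2) * M).
  { apply abs_RInt_le_const; [lra|auto|]. intros t Ht.
    eapply Rle_trans; [apply Rabs_Im_le|]; apply HM, Rabs_le; auto. }
  lra.
Qed.

Lemma Re_minus (z w : C) : Re (z - w) = Re z - Re w.
Proof. reflexivity. Qed.
Lemma Im_minus (z w : C) : Im (z - w) = Im z - Im w.
Proof. reflexivity. Qed.
Lemma Re_scal (x : R) (z : C) : Re (x * z) = x * Re z.
Proof. unfold Re, Im; simpl; unfold Re, Im; ring. Qed.
Lemma Im_scal (x : R) (z : C) : Im (x * z) = x * Im z.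
Proof. unfold Re, Im; simpl; unfold Re, Im; ring. Qed.

Lemma cdiff_is_derive (F F' : C -> C) (x : R) (w : C) : cdiff F F' ->
  is_derive (fun t : R => Re (F (t + w)%C)) x (Re (F' (x + w)%C)) /\
  is_derive (fun t : R => Im (F (t + w)%C)) x (Im (F' (x + w)%C)).
Proof.
  intros D; destruct (D (Rmax 1 (Cmod (x + w)))) as [M HM].
  assert (E : forall h : R, Rabs h <= 1 ->
    Cmod (F (RtoC (x + h) + w)%C - F (x + w)%C - h * F' (x + w)%C)%C <= M * Rabs h ^ 2).
  { intros h Hh. rewrite <- Cmod_R.
    replace (RtoC (x + h) + w)%C with (x + w + h)%C by (rewrite RtoC_plus; ring).
    apply HM; [apply Rmax_r|rewrite Cmod_R; eapply Rle_trans; [exact Hh|apply Rmax_l]]. }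
  split; apply is_derive_of_quadratic_bound with M; intros h Hh.
  - rewrite <- Re_scal, <- !Re_minus. eapply Rle_trans; [apply Rabs_Re_le|auto].
  - rewrite <- Im_scal, <- !Im_minus. eapply Rle_trans; [apply Rabs_Im_le|auto].
Qed.

Lemma cdiff_ccont_derivative (F F' : C -> C) (w : C) : cdiff F F' ->
  ccont (fun x => F' (x + w)%C).
Proof.
  intros D x _; destruct (cdiff_lipschitz F F' D (Rmax 1 (Cmod (x + w)))) as [M HM].
  assert (E : forall h : R, Rabs h <= 1 ->
    Cmod (F' (RtoC (x + h) + w)%C - F' (x + w)%C)%C <= M * Rabs h).
  { intros h Hh. rewrite <- Cmod_R.
    replace (RtoC (x + h) + w)%C with (x + w + h)%C by (rewrite RtoC_plus; ring).
    apply HM; [apply Rmax_r|rewrite Cmod_R; eapply Rle_trans; [exact Hh|apply Rmax_l]]. }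
  split; apply continuous_of_linear_bound with M; intros h Hh.
  - rewrite <- !Re_minus. eapply Rle_trans; [apply Rabs_Re_le|auto].
  - rewrite <- !Im_minus. eapply Rle_trans; [apply Rabs_Im_le|auto].
Qed.

Lemma cdiff_ccont (F F' : C -> C) (w : C) : cdiff F F' -> ccont (fun x => F (x + w)%C).
Proof.
  intros D x _; destruct (cdiff_is_derive F F' x w D); split;
    apply (ex_derive_continuous (K := R_AbsRing) (V := R_NormedModule)); eexists; eassumption.
Qed.

Lemma Cint_derivative (F F' : C -> C) (w : C) : cdiff F F' ->
  Cint (fun x => F' (x + w)%C) = (F (RtoC (/ 2) + w) - F (RtoC (- / 2) + w))%C.
Proof.
  intros D. pose proof (cdiff_ccont_derivative F F' w D) as HC.
  apply C_ext; simpl; apply is_RInt_unique.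
  - apply (is_RInt_derive (V := R_CompleteNormedModule) (fun x : R => Re (F (x + w)%C))).
    + intros x _; apply (cdiff_is_derive F F' x w D).
    + intros x Hx; apply HC, Rabs_le_half, Hx.
  - apply (is_RInt_derive (V := R_CompleteNormedModule) (fun x : R => Im (F (x + w)%C))).
    + intros x _; apply (cdiff_is_derive F F' x w D).
    + intros x Hx; apply HC, Rabs_le_half, Hx.
Qed.

(* The increment of [t |-> Cint (g (x + t w))] is quadratic in the step, because the integral of
   the derivative of [g] over a period vanishes. *)
Lemma Cint_shift (g g' : C -> C) (w : C) : cdiff g g' ->
  (forall z, g (z + 1)%C = g z) ->
  Cint (fun x => g (x + w)%C) = Cint (fun x => g x).
Proof.
  intros D P.
  set (J := fun t : R => Cint (fun x => g (x + t * w)%C)).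
  assert (Q : forall t : R, exists M, forall s, Rabs s <= 1 ->
            Cmod (J (t + s)%R - J t)%C <= M * Rabs s ^ 2).
  { intros t. destruct (D (/ 2 + Cmod (t * w) + Cmod w)) as [M HM].
    exists (2 * (M * Cmod w ^ 2)); intros s Hs.
    assert (Z0 : Cint (fun x => g' (x + t * w)%C) = 0%C).
    { rewrite (Cint_derivative g g' _ D).
      replace (RtoC (/ 2) + t * w)%C with (RtoC (- / 2) + t * w + 1)%C.
      - rewrite P; ring.
      - replace (RtoC (/ 2)) with (RtoC (- / 2) + 1)%C; [ring|].
        rewrite <- RtoC_plus; f_equal; field. }
    replace (J (t + s)%R - J t)%C with
      (Cint (fun x => g (x + RtoC (t + s) * w)%C - g (x + t * w)%C - s * w * g' (x + t * w)%C)%C).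
    - rewrite Rmult_assoc. apply Cmod_Cint_le.
      + apply ccont_minus; [apply ccont_minus|apply ccont_scal].
        * apply (cdiff_ccont g g' _ D).
        * apply (cdiff_ccont g g' _ D).
        * apply (cdiff_ccont_derivative g g' _ D).
      + intros x Hx.
        replace (x + RtoC (t + s) * w)%C with (x + t * w + s * w)%C by (rewrite RtoC_plus; ring).
        eapply Rle_trans; [apply HM|].
        * eapply Rle_trans; [apply Cmod_triangle|]. rewrite Cmod_R. pose proof (Cmod_ge_0 w). lra.
        * rewrite Cmod_mult, Cmod_R. pose proof (Cmod_ge_0 w); pose proof (Cmod_ge_0 (t * w)). nra.
        * rewrite Cmod_mult, Cmod_R. right; ring.
    - assert (H1 := cdiff_ccont g g' (RtoC (t + s) * w)%C D).
      assert (H2 := cdiff_ccont g g' (t * w)%C D).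
      assert (H3 := cdiff_ccont_derivative g g' (t * w)%C D).
      rewrite (Cint_minus _ _ (ccont_minus _ _ H1 H2) (ccont_scal (s * w) _ H3)),
        (Cint_minus _ _ H1 H2), (Cint_scal _ _ H3), Z0. unfold J; ring. }
  assert (K : J 1 = J 0).
  { apply C_ext; symmetry.
    - apply (eq_is_derive (V := R_NormedModule) (fun t => Re (J t))); [|lra].
      intros t _; destruct (Q t) as [M HM]. apply is_derive_of_quadratic_bound with M.
      intros h Hh. change (zero (G := R_NormedModule)) with 0. rewrite Rmult_0_r, Rminus_0_r, <- Re_minus.
      eapply Rle_trans; [apply Rabs_Re_le|auto].
    - apply (eq_is_derive (V := R_NormedModule) (fun t => Im (J t))); [|lra].
      intros t _; destruct (Q t) as [M HM]. apply is_derive_of_quadratic_bound with M.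
      intros h Hh. change (zero (G := R_NormedModule)) with 0. rewrite Rmult_0_r, Rminus_0_r, <- Im_minus.
      eapply Rle_trans; [apply Rabs_Im_le|auto]. }
  unfold J in K.
  transitivity (Cint (fun x => g (x + 1 * w)%C)); [|transitivity (Cint (fun x => g (x + 0 * w)%C))].
  - apply Cint_ext; intros; f_equal; ring.
  - exact K.
  - apply Cint_ext; intros; f_equal; ring.
Qed.

(** * Fourier coefficients of quasi-periodic functions *)

Definition fourier (h : R -> C) (k : Z) : C := Cint (fun x => h x * ee (RtoC (- IZR k) * x))%C.

Definition energy (h : R -> C) : R := RInt (fun x => Cmod (h x) ^ 2) (- / 2) (/ 2).

Lemma Cmod_sqr (z : C) : Cmod z ^ 2 = Re z ^ 2 + Im z ^ 2.
Proof.
  unfold Cmod; rewrite pow2_sqrt; [reflexivity|].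
  pose proof (pow2_ge_0 (fst z)); pose proof (pow2_ge_0 (snd z)); lra.
Qed.

Lemma ccont_ext (F G : R -> C) : (forall x, F x = G x) -> ccont F -> ccont G.
Proof.
  intros H HF x Hx; destruct (HF x Hx); split.
  - apply (continuous_ext (fun t => Re (F t))); auto; intros; rewrite H; auto.
  - apply (continuous_ext (fun t => Im (F t))); auto; intros; rewrite H; auto.
Qed.

Lemma cdiff_ee_linear (a : C) :
  cdiff (fun z => ee (a * z)) (fun z => RtoC (2 * PI) * Ci * (a * 1) * ee (a * z))%C.
Proof. apply (cdiff_ee _ _ (cdiff_scal a _ _ cdiff_id)). Qed.

Lemma cdiff_ccont_0 (F F' : C -> C) : cdiff F F' -> ccont (fun x => F x).
Proof.
  intros D; apply (ccont_ext (fun x => F (x + 0)%C)); [intros; f_equal; ring|].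
  apply (cdiff_ccont F F' 0 D).
Qed.

Lemma ccont_ee (a : C) : ccont (fun x => ee (a * x)).
Proof. apply (cdiff_ccont_0 _ _ (cdiff_ee_linear a)). Qed.

Lemma ccont_fourier (h : R -> C) (k : Z) : ccont h ->
  ccont (fun x => h x * ee (RtoC (- IZR k) * x))%C.
Proof. intros; apply ccont_mult; [auto|apply ccont_ee]. Qed.

Lemma two_pi_Ci_neq_0 : (RtoC (2 * PI) * Ci)%C <> 0%C.
Proof. intros H; apply (f_equal Im) in H; simpl in H. pose proof PI_RGT_0. lra. Qed.

Lemma Cint_ee (k : Z) : k <> 0%Z -> Cint (fun x => ee (RtoC (IZR k) * x)) = 0%C.
Proof.
  intros Hk.
  pose proof (Cint_derivative _ _ 0%C (cdiff_ee_linear (RtoC (IZR k)))) as H; cbv beta in H.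
  replace (RtoC (IZR k) * (RtoC (/ 2) + 0))%C
    with (RtoC (IZR k) * (RtoC (- / 2) + 0) + RtoC (IZR k))%C in H.
  2:{ replace (RtoC (/ 2)) with (RtoC (- / 2) + 1)%C; [ring|].
      rewrite <- RtoC_plus; f_equal; field. }
  rewrite ee_plus_Z in H.
  rewrite (Cint_ext _ (fun x => RtoC (2 * PI) * Ci * RtoC (IZR k) * ee (RtoC (IZR k) * x))%C) in H.
  2:{ intros; rewrite Cmult_1_r, Cplus_0_r; reflexivity. }
  rewrite Cint_scal in H by apply ccont_ee.
  assert (RtoC (IZR k) <> 0%C) by (intros E; apply RtoC_inj, eq_IZR in E; auto).
  pose proof two_pi_Ci_neq_0 as P2.
  replace (Cint (fun x => ee (RtoC (IZR k) * x)))
    with (/ (RtoC (2 * PI) * Ci) * / RtoC (IZR k) *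
      (RtoC (2 * PI) * Ci * RtoC (IZR k) * Cint (fun x => ee (RtoC (IZR k) * x))))%C.
  - rewrite H. ring.
  - remember (RtoC (2 * PI) * Ci)%C as u. field; auto.
Qed.

Lemma fourier_sub_character (h : R -> C) (c : C) (k j : Z) : ccont h -> j <> k ->
  fourier (fun x => h x - c * ee (RtoC (IZR k) * x))%C j = fourier h j.
Proof.
  intros Hh Hj; unfold fourier.
  transitivity (Cint (fun x => h x * ee (RtoC (- IZR j) * x)
                             - c * ee (RtoC (IZR (k - j)) * x))%C).
  { apply Cint_ext; intros x _.
    replace (RtoC (IZR (k - j)) * x)%C with (RtoC (IZR k) * x + RtoC (- IZR j) * x)%C.
    - rewrite ee_plus; ring.
    - rewrite minus_IZR, RtoC_minus, RtoC_opp; ring. }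
  rewrite Cint_minus; [|apply ccont_fourier, Hh|apply ccont_scal, ccont_ee].
  rewrite Cint_scal by apply ccont_ee. rewrite Cint_ee by lia. ring.
Qed.

Lemma ex_RInt_energy (h : R -> C) : ccont h -> ex_RInt (fun x => Cmod (h x) ^ 2) (- / 2) (/ 2).
Proof.
  intros Hh; apply (ex_RInt_ext (fun x => Re (h x) * Re (h x) + Im (h x) * Im (h x))).
  { intros; rewrite Cmod_sqr; simpl; ring. }
  apply (@ex_RInt_continuous R_CompleteNormedModule); intros x Hx.
  destruct (Hh x (Rabs_le_half x Hx)).
  apply (continuous_plus (V := R_NormedModule)
    (fun x => Re (h x) * Re (h x)) (fun x => Im (h x) * Im (h x)));
    apply (continuous_mult (K := R_AbsRing)); auto.
Qed.

Lemma energy_ge_0 (h : R -> C) : ccont h -> 0 <= energy h.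
Proof.
  intros Hh; apply RInt_ge_0; [lra|apply ex_RInt_energy, Hh|].
  intros; apply pow2_ge_0.
Qed.

(** Pythagoras: since the character has modulus 1, the integrand is [|g - c|^2] with
    [g = h e(-k x)], and the integral of [g] is [c] itself. *)
Lemma energy_sub_fourier (h : R -> C) (k : Z) : ccont h ->
  energy (fun x => h x - fourier h k * ee (RtoC (IZR k) * x))%C
  = energy h - Cmod (fourier h k) ^ 2.
Proof.
  intros Hh. set (g := fun x : R => (h x * ee (RtoC (- IZR k) * x))%C).
  assert (Hg : ccont g) by (apply ccont_fourier; auto).
  set (c := fourier h k).
  destruct (ccont_ex_RInt g Hg) as [G1 G2].
  assert (E : forall x : R, Cmod (h x - c * ee (RtoC (IZR k) * x))%C ^ 2
    = Cmod (h x) ^ 2 + 1 * (- 2 * Re c * Re (g x) + - 2 * Im c * Im (g x)) + Cmod c ^ 2).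
  { intros x. assert (U : (ee (RtoC (- IZR k) * x) * ee (RtoC (IZR k) * x))%C = 1%C).
    { rewrite <- ee_opp with (z := (RtoC (IZR k) * x)%C). do 2 f_equal. rewrite RtoC_opp; ring. }
    assert (U1 : Cmod (ee (RtoC (IZR k) * x)) = 1).
    { rewrite Cmod_ee. simpl. rewrite <- exp_0; f_equal; ring. }
    replace (h x) with (g x * ee (RtoC (IZR k) * x))%C at 1 2.
    - replace (g x * ee (RtoC (IZR k) * x) - c * ee (RtoC (IZR k) * x))%C
        with ((g x - c) * ee (RtoC (IZR k) * x))%C by ring.
      rewrite !Cmod_mult, U1, !Rmult_1_r, !Cmod_sqr, Re_minus, Im_minus. ring.
    - unfold g. rewrite <- Cmult_assoc, U; ring. }
  assert (I1 : is_RInt (fun x => Cmod (h x) ^ 2) (- / 2) (/ 2) (energy h))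
    by (apply (RInt_correct (V := R_CompleteNormedModule)), ex_RInt_energy, Hh).
  assert (I2 : is_RInt (fun x => Re (g x)) (- / 2) (/ 2) (Re c))
    by (apply (RInt_correct (V := R_CompleteNormedModule)), G1).
  assert (I3 : is_RInt (fun x => Im (g x)) (- / 2) (/ 2) (Im c))
    by (apply (RInt_correct (V := R_CompleteNormedModule)), G2).
  unfold energy at 1. rewrite (RInt_ext _ _ _ _ (fun x _ => E x)).
  apply is_RInt_unique.
  replace (energy h - Cmod c ^ 2)
    with (energy h + 1 * (- 2 * Re c * Re c + - 2 * Im c * Im c) + (/ 2 - - / 2) * Cmod c ^ 2)
    by (rewrite Cmod_sqr; field).
  apply (is_RInt_plus (V := R_NormedModule) _ (fun _ => Cmod c ^ 2));
    [|apply (is_RInt_const (V := R_NormedModule))].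
  apply (is_RInt_plus (V := R_NormedModule) (fun x => Cmod (h x) ^ 2)); [exact I1|].
  apply (is_RInt_scal (V := R_NormedModule)).
  apply (is_RInt_plus (V := R_NormedModule)
    (fun x => - 2 * Re c * Re (g x)) (fun x => - 2 * Im c * Im (g x)));
    apply (is_RInt_scal (V := R_NormedModule)); assumption.
Qed.

(** Bessel's inequality for [N] consecutive coefficients of equal modulus. Removing the last
    character from [h] lowers the energy by [v] and keeps the other coefficients, so the induction
    runs over all [h]. *)
Lemma bessel (N : nat) (k0 : Z) (v : R) : forall h : R -> C, ccont h ->
  (forall j, (j < N)%nat -> Cmod (fourier h (k0 + Z.of_nat j)) ^ 2 = v) ->
  INR N * v <= energy h.
Proof.
  induction N as [|N IH]; intros h Hh Hv.
  - simpl; rewrite Rmult_0_l; apply energy_ge_0, Hh.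
  - set (k := (k0 + Z.of_nat N)%Z).
    pose proof (energy_sub_fourier h k Hh) as E.
    assert (Hc : ccont (fun x => h x - fourier h k * ee (RtoC (IZR k) * x))%C).
    { apply ccont_minus; [auto|apply ccont_scal, ccont_ee]. }
    assert (B := IH _ Hc). rewrite E in B.
    rewrite S_INR. pose proof (Hv N (Nat.lt_succ_diag_r N)) as HN; fold k in HN; rewrite HN in B.
    enough (INR N * v <= energy h - v) by lra. apply B.
    intros j Hj; rewrite fourier_sub_character; [apply Hv; lia|auto|unfold k; lia].
Qed.

(** A nonzero value repeated in arbitrarily long runs would exceed the finite energy. The start
    [k0 N] may depend on the length, so that runs towards minus infinity are covered too. *)
Lemma fourier_const_run (h : R -> C) (c : C) (k0 : nat -> Z) : ccont h ->
  (forall N j, (j < N)%nat -> fourier h (k0 N + Z.of_nat j) = c) -> c = 0%C.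
Proof.
  intros Hh H. apply Cmod_eq_0.
  destruct (Rle_lt_or_eq_dec 0 (Cmod c) (Cmod_ge_0 c)) as [P|P]; [exfalso|auto].
  assert (Q : 0 < Cmod c ^ 2) by (apply pow_lt; auto).
  destruct (INR_archimed (Cmod c ^ 2) (energy h) Q) as [N HN].
  assert (B := bessel N (k0 N) (Cmod c ^ 2) h Hh). 
  enough (INR N * Cmod c ^ 2 <= energy h) by lra.
  apply B; intros j Hj; rewrite H; auto.
Qed.

(** * Vanishing Fourier coefficients force a zero value *)

Definition diffquot (F F' : C -> C) (x : R) : C :=
  if Req_EM_T x 0 then F' 0%C else (RtoC (/ x) * (F x - F 0))%C.

Lemma diffquot_spec (F F' : C -> C) (x : R) : (x * diffquot F F' x)%C = (F x - F 0)%C.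
Proof.
  unfold diffquot; destruct (Req_EM_T x 0) as [->|H]; [ring|].
  rewrite Cmult_assoc, <- RtoC_mult, Rinv_r by auto; ring.
Qed.

Lemma ccont_diffquot (F F' : C -> C) : cdiff F F' -> ccont (diffquot F F').
Proof.
  intros D x Hx; destruct (Req_dec x 0) as [->|Hx0].
  - destruct (D 1) as [M HM].
    assert (E : forall h : R, Rabs h <= 1 ->
      Cmod (diffquot F F' (0 + h)%R - diffquot F F' 0%R)%C <= Rabs M * Rabs h).
    { intros h Hh; rewrite Rplus_0_l; unfold diffquot at 2.
      destruct (Req_EM_T 0 0) as [_|N]; [|congruence].
      destruct (Req_dec h 0) as [->|Hh0].
      - unfold diffquot; destruct (Req_EM_T 0 0) as [_|N]; [|congruence].
        replace (F' 0 - F' 0)%C with (RtoC 0) by ring. rewrite Cmod_0, Rabs_R0; lra.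
      - pose proof (Rabs_pos_lt h Hh0).
        apply Rmult_le_reg_l with (Rabs h); [auto|].
        rewrite <- Cmod_R at 1. rewrite <- Cmod_mult.
        replace (h * (diffquot F F' h - F' 0))%C with (F (0 + h)%C - F 0%C - h * F' 0%C)%C.
        + destruct (HM 0%C h) as (_ & _ & A3); [rewrite Cmod_0; lra|rewrite Cmod_R; auto|].
          eapply Rle_trans; [exact A3|]. rewrite Cmod_R. pose proof (Rle_abs M). nra.
        + rewrite Cplus_0_l.
          replace (h * (diffquot F F' h - F' 0))%C with (h * diffquot F F' h - h * F' 0)%C by ring.
          rewrite diffquot_spec; ring. }
    split; apply continuous_of_linear_bound with (Rabs M); intros h Hh.
    + rewrite <- Re_minus; eapply Rle_trans; [apply Rabs_Re_le|auto].
    + rewrite <- Im_minus; eapply Rle_trans; [apply Rabs_Im_le|auto].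
  (* Away from 0 the case distinction in [diffquot] has a locally constant outcome, so the quotient
     formula can be used. *)
  - assert (L : locally x (fun t : R => t <> 0)).
    { exists (mkposreal _ (Rabs_pos_lt x Hx0)); intros t Ht ->.
      unfold ball in Ht; simpl in Ht; unfold AbsRing_ball, abs, minus, plus, opp in Ht; simpl in Ht.
      rewrite Rplus_0_l, Rabs_Ropp in Ht; lra. }
    assert (Ci : continuous Rinv x).
    { apply continuity_pt_filterlim. apply continuity_pt_ext with (fun t => / id t); [reflexivity|].
      apply (continuity_pt_inv id); [apply derivable_continuous_pt, derivable_pt_id|exact Hx0]. }
    assert (Cf : ccont (fun x => F x - F 0)%C).
    { apply ccont_minus; [apply (cdiff_ccont_0 F F' D)|apply ccont_const]. }
    destruct (Cf x Hx) as [C1 C2].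
    split.
    + apply (continuous_ext_loc (U := R_UniformSpace) (fun t => Re (diffquot F F' t))
        (fun t => / t * Re (F t - F 0))).
      * revert L; apply filter_imp; intros t Ht; unfold diffquot.
        destruct (Req_EM_T t 0); [contradiction|]. rewrite Re_scal; reflexivity.
      * apply (continuous_mult (K := R_AbsRing)); auto.
    + apply (continuous_ext_loc (U := R_UniformSpace) (fun t => Im (diffquot F F' t))
        (fun t => / t * Im (F t - F 0))).
      * revert L; apply filter_imp; intros t Ht; unfold diffquot.
        destruct (Req_EM_T t 0); [contradiction|]. rewrite Im_scal; reflexivity.
      * apply (continuous_mult (K := R_AbsRing)); auto.
Qed.

Lemma ccont_inv (F : R -> C) : ccont F -> (forall x, Rabs x <= / 2 -> F x <> 0%C) ->
  ccont (fun x => / F x)%C.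
Proof.
  intros HF H0 x Hx; destruct (HF x Hx) as [C1 C2].
  assert (N : Re (F x) ^ 2 + Im (F x) ^ 2 <> 0).
  { rewrite <- Cmod_sqr. apply pow_nonzero. pose proof (proj1 (Cmod_gt_0 _) (H0 x Hx)); lra. }
  apply continuity_pt_filterlim in C1, C2.
  assert (Q : continuity_pt (fun t => Re (F t) ^ 2 + Im (F t) ^ 2) x).
  { apply continuity_pt_ext with (fun t => Re (F t) * Re (F t) + Im (F t) * Im (F t)).
    - intros; ring.
    - apply continuity_pt_plus; apply continuity_pt_mult; assumption. }
  split; apply continuity_pt_filterlim.
  - apply (continuity_pt_div _ _ _ C1 Q N).
  - apply (continuity_pt_div (fun t => - Im (F t)) _ _); [apply (continuity_pt_opp _ _ C2)|exact Q|exact N].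
Qed.

Lemma ee_neq_1 (x : R) : Rabs x <= / 2 -> x <> 0 -> ee x <> 1%C.
Proof.
  intros H H0 E; rewrite ee_real in E; apply (f_equal Re) in E; simpl in E.
  replace (2 * PI * x) with (2 * (PI * x)) in E by ring.
  rewrite cos_2a_sin in E.
  assert (S0 : sin (PI * x) = 0) by nra.
  pose proof PI_RGT_0 as P.
  unfold Rabs in H; destruct (Rcase_abs x) as [L|L].
  - assert (0 < sin (PI * - x)) by (apply sin_gt_0; nra).
    replace (PI * - x) with (- (PI * x)) in H1 by ring. rewrite sin_neg in H1. lra.
  - assert (0 < sin (PI * x)) by (apply sin_gt_0; nra). lra.
Qed.

(* Dividing [U - U 0] by [e(x) - 1] gives a continuous [h] whose Fourier coefficients are constant
   on [k >= 0] and on [k < 0], with jump [U 0] in between; Bessel makes both constants vanish. *)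
Lemma fourier_zero_vanish (U U' : C -> C) : cdiff U U' ->
  (forall k, fourier (fun x => U x) k = 0%C) -> U 0%C = 0%C.
Proof.
  intros D Hk.
  set (E' := fun z => (RtoC (2 * PI) * Ci * (1 * 1) * ee (1 * z))%C).
  assert (DE : cdiff (fun z => ee (1 * z)) E') by apply cdiff_ee_linear.
  set (s := diffquot (fun z => ee (1 * z)) E').
  assert (Hs0 : forall x, Rabs x <= / 2 -> s x <> 0%C).
  { intros x Hx Z; destruct (Req_dec x 0) as [->|Hx0].
    - unfold s, diffquot in Z; destruct (Req_EM_T 0 0) as [_|N]; [|congruence].
      unfold E' in Z; rewrite Cmult_0_r, ee_0, !Cmult_1_r in Z.
      apply two_pi_Ci_neq_0, Z.
    - pose proof (diffquot_spec (fun z => ee (1 * z)) E' x) as Q; fold s in Q.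
      rewrite Z, !Cmult_0_r, Cmult_1_l, ee_0 in Q.
      apply (ee_neq_1 x Hx Hx0).
      replace (ee x) with (ee x - 1 + 1)%C by ring. rewrite <- Q; ring. }
  set (h := fun x => (diffquot U U' x * / s x)%C).
  assert (Hh : ccont h).
  { apply ccont_mult; [apply ccont_diffquot, D|apply ccont_inv; [apply ccont_diffquot, DE|exact Hs0]]. }
  assert (Hspec : forall x, Rabs x <= / 2 -> (h x * (ee x - 1))%C = (U x - U 0)%C).
  { intros x Hx; rewrite <- (diffquot_spec U U' x).
    pose proof (diffquot_spec (fun z => ee (1 * z)) E' x) as Q; fold s in Q; cbv beta in Q.
    rewrite Cmult_0_r, ee_0, Cmult_1_l in Q; rewrite <- Q.
    unfold h; field; auto. }
  assert (CU : ccont (fun x => U x)) by apply (cdiff_ccont_0 U U' D).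
  (* Lowering the index by one multiplies the integrand by [e(x)]; the difference of neighbouring
     coefficients of [h] is therefore a coefficient of [h (e(x) - 1) = U - U 0]. *)
  assert (R1 : forall k, (fourier h (k - 1) - fourier h k)%C
                         = (fourier (fun x => U x) k - U 0 * Cint (fun x => ee (RtoC (IZR (- k)) * x)))%C).
  { intros k. unfold fourier. rewrite <- Cint_scal by apply ccont_ee.
    rewrite <- Cint_minus by (apply ccont_fourier; assumption).
    rewrite <- Cint_minus; [|apply ccont_fourier; assumption|apply ccont_scal, ccont_ee].
    apply Cint_ext; intros x Hx.
    replace (RtoC (- IZR (k - 1)) * x)%C with (RtoC (- IZR k) * x + x)%C
      by (rewrite minus_IZR, !RtoC_opp, RtoC_minus; ring).
    rewrite ee_plus, opp_IZR.
    transitivity (h x * (ee x - 1) * ee (RtoC (- IZR k) * x))%C; [ring|].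
    rewrite Hspec by auto; ring. }
  assert (R2 : forall k, k <> 0%Z -> fourier h (k - 1) = fourier h k).
  { intros k K. specialize (R1 k). rewrite Hk, Cint_ee in R1 by lia.
    replace (fourier h (k - 1)) with (fourier h (k - 1) - fourier h k + fourier h k)%C by ring.
    rewrite R1; ring. }
  assert (P0 : forall n : nat, fourier h (Z.of_nat n) = fourier h 0).
  { induction n as [|n IH]; [reflexivity|]. rewrite <- IH, <- R2 by lia. f_equal; lia. }
  assert (P1 : forall n : nat, fourier h (- 1 - Z.of_nat n) = fourier h (- 1)).
  { induction n as [|n IH]; [reflexivity|].
    rewrite <- IH, <- (R2 (- 1 - Z.of_nat n)%Z) by lia. f_equal; lia. }
  assert (Z0 : fourier h 0 = 0%C).
  { apply (fourier_const_run h _ (fun _ => 0%Z) Hh). intros N j _; apply P0. }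
  (* The run of length [N] that starts at [- N] ends at -1, just before the jump. *)
  assert (Z1 : fourier h (- 1) = 0%C).
  { apply (fourier_const_run h _ (fun N => (- Z.of_nat N)%Z) Hh). intros N j Hj.
    rewrite <- (P1 (N - 1 - j)%nat). f_equal; lia. }
  (* At [k = 0] both sides of the jump are now 0, which leaves [U 0 = 0]. *)
  specialize (R1 0%Z). change (0 - 1)%Z with (- 1)%Z in R1. rewrite Hk, Z0, Z1 in R1.
  rewrite (Cint_ext _ (fun _ => 1%C)) in R1.
  - rewrite Cint_const in R1. replace (U 0%C) with (- (0 - U 0 * 1))%C by ring. rewrite <- R1; ring.
  - intros x _. simpl. rewrite Cmult_0_l; apply ee_0.
Qed.

(** The sign in [F (z + 1) = - F z] makes [F(z) e(-(n + 1/2) z)] periodic, and its integral may be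
    moved to the line through [tau]. There the second quasi-period turns coefficient [n] into
    coefficient [n + 1] times [- e(-(n + 1) tau)]. This factor is never 0, so one vanishing
    coefficient propagates in both directions. *)
Lemma quasiperiodic_zero (tau : C) (F F' : C -> C) : cdiff F F' ->
  (forall z, F (z + 1)%C = (- F z)%C) ->
  (forall z, F (z + tau)%C = (- (ee (- (tau * RtoC (/ 2)) - z) * F z))%C) ->
  Cint (fun x => F x * ee (RtoC (- / 2) * x))%C = 0%C ->
  forall z, F z = 0%C.
Proof.
  intros D P1 Pt Z0.
  set (g := fun (n : Z) (z : C) => (F z * ee (RtoC (- IZR n - / 2) * z))%C).
  assert (Dg : forall n, exists g', cdiff (g n) g').
  { intros n; eexists; apply cdiff_mult; [exact D|apply cdiff_ee_linear]. }
  assert (Pg : forall n z, g n (z + 1)%C = g n z).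
  { intros n z; unfold g; rewrite P1.
    replace (RtoC (- IZR n - / 2) * (z + 1))%C
      with (RtoC (- IZR n - / 2) * z + RtoC (/ 2) + RtoC (IZR (- n - 1)))%C.
    - rewrite ee_plus_Z, ee_plus, ee_half; ring.
    - replace (IZR (- n - 1)) with ((- IZR n - / 2) - / 2) by (rewrite minus_IZR, opp_IZR; field).
      rewrite (RtoC_minus (- IZR n - / 2) (/ 2)); ring. }
  assert (Sh : forall n w, Cint (fun x => g n (x + w)%C) = Cint (fun x => g n x)).
  { intros n w; destruct (Dg n) as [g' Hg]; apply (Cint_shift _ _ w Hg); apply Pg. }
  assert (Cg : forall n, ccont (fun x => g n x)).
  { intros n; destruct (Dg n) as [g' Hg]; apply (cdiff_ccont_0 _ _ Hg). }
  assert (Rec : forall n, Cint (fun x => g n x)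
     = (- ee (- (RtoC (IZR (n + 1)) * tau)) * Cint (fun x => g (n + 1)%Z x))%C).
  { intros n. rewrite <- (Sh n tau), <- Cint_scal by apply Cg.
    apply Cint_ext; intros x _; unfold g; rewrite Pt.
    replace (RtoC (- IZR n - / 2) * (x + tau))%C
      with ((- (RtoC (IZR (n + 1)) * tau) + RtoC (- IZR (n + 1) - / 2) * x)
            - (- (tau * RtoC (/ 2)) - x))%C.
    - unfold Cminus at 2. rewrite !ee_plus.
      pose proof (ee_opp (- (tau * RtoC (/ 2)) - x)) as O.
      set (u := ee (- (tau * RtoC (/ 2)) - x)) in *.
      set (v := ee (- (- (tau * RtoC (/ 2)) - x))) in *.
      transitivity (- ee (- (RtoC (IZR (n + 1)) * tau)) * F x
        * ee (RtoC (- IZR (n + 1) - / 2) * x) * (v * u))%C; [ring|rewrite O; ring].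
    - rewrite plus_IZR, !RtoC_minus, !RtoC_opp, RtoC_plus.
      replace (RtoC (/ 2)) with (1 / 2)%C by (rewrite RtoC_inv by lra; field).
      field. }
  assert (Up : forall n : nat, Cint (fun x => g (Z.of_nat n) x) = 0%C).
  { induction n as [|n IH].
    - rewrite <- Z0; apply Cint_ext; intros; unfold g; simpl. do 3 f_equal. rewrite Ropp_0; f_equal; ring.
    - rewrite Rec in IH. rewrite Nat2Z.inj_succ; unfold Z.succ.
      pose proof (ee_neq_0 (- (RtoC (IZR (Z.of_nat n + 1)) * tau))) as N.
      set (u := ee (- (RtoC (IZR (Z.of_nat n + 1)) * tau))) in *.
      set (v := Cint (fun x : R => g (Z.of_nat n + 1)%Z x)) in *.
      replace v with (- / u * (- u * v))%C by (field; auto). rewrite IH; ring. }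
  assert (Dn : forall n : nat, Cint (fun x => g (- Z.of_nat n)%Z x) = 0%C).
  { induction n as [|n IH]; [apply (Up 0%nat)|].
    rewrite Rec. replace (- Z.of_nat (S n) + 1)%Z with (- Z.of_nat n)%Z by lia. rewrite IH; ring. }
  assert (All : forall n, Cint (fun x => g n x) = 0%C).
  { intros n; destruct (Z_le_gt_dec 0 n).
    - rewrite <- (Z2Nat.id n) by lia; apply Up.
    - replace n with (- Z.of_nat (Z.to_nat (- n)))%Z by lia. apply Dn. }
  intros z.
  destruct (Dg 0%Z) as [g' Hg].
  (* [fourier_zero_vanish] speaks of the value at 0, so it is applied to the translate by [z]. The
     translate has coefficients [e(k z)] times those of [g 0], again because the line of integration
     may be moved. *)
  assert (V : g 0%Z (0 + z)%C = 0%C).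
  { apply (fourier_zero_vanish (fun x => g 0%Z (x + z)%C) _ (cdiff_translate z _ _ Hg)).
    intros k; unfold fourier.
    rewrite (Cint_ext _ (fun x => ee (RtoC (IZR k) * z) * g k (x + z))%C).
    - rewrite Cint_scal.
      + rewrite Sh, All; ring.
      + destruct (Dg k) as [gk' Hgk]; apply (cdiff_ccont _ _ z Hgk).
    - intros x _; unfold g.
      replace (RtoC (- IZR k - / 2) * (x + z))%C
        with (RtoC (- IZR 0 - / 2) * (x + z) + RtoC (- IZR k) * x + - (RtoC (IZR k) * z))%C.
      + rewrite !ee_plus. pose proof (ee_opp (RtoC (IZR k) * z)) as O.
        set (u := ee (RtoC (IZR k) * z)) in *. set (v := ee (- (RtoC (IZR k) * z))) in *.
        transitivity (F (x + z) * ee (RtoC (- IZR 0 - / 2) * x)%C * ee (RtoC (- IZR 0 - / 2) * z)%C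
                      * ee (RtoC (- IZR k) * x) * (v * u))%C.
        * rewrite O. rewrite Cmult_plus_distr_l, ee_plus. ring.
        * rewrite Cmult_plus_distr_l, ee_plus. ring.
      + rewrite !RtoC_minus, !RtoC_opp. ring. }
  rewrite Cplus_0_l in V; unfold g in V.
  pose proof (ee_neq_0 (RtoC (- IZR 0 - / 2) * z)) as N.
  set (u := ee (RtoC (- IZR 0 - / 2) * z)) in *.
  replace (F z) with (F z * u * / u)%C by (field; auto). rewrite V; ring.
Qed.

(** * Two-sided series and the Jacobi theta function *)

Definition Ccv (u : nat -> C) (l : C) : Prop :=
  forall eps, 0 < eps -> exists N, forall n, (N <= n)%nat -> Cmod (u n - l) < eps.

Lemma Ccv_filterlim (u : nat -> C) (l : C) :
  filterlim u eventually (locally (T := C_NormedModule) l) <-> Ccv u l.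
Proof.
  split; intros H.
  - intros eps He.
    apply (proj1 (filterlim_locally_ball_norm (U := C_NormedModule) u l) H (mkposreal eps He)).
  - apply (filterlim_locally_ball_norm (U := C_NormedModule) u l).
    intros eps; apply H, cond_pos.
Qed.

(** [limC] is defined for every sequence. A limit in hand makes the image filter Cauchy, so [limC]
    is a limit by completeness and equals [l] by uniqueness. *)
Lemma Ccv_limC (u : nat -> C) (l : C) : Ccv u l -> limC u = l.
Proof.
  intros H; apply Ccv_filterlim in H.
  assert (HC : filterlim u eventually (locally (T := C_NormedModule) (limC u))).
  { apply filterlim_locally; intros eps.
    apply (complete_cauchy (T := C_CompleteNormedModule) (filtermap u eventually)).
    - apply filtermap_proper_filter, eventually_filter.
    - intros e; exists l. apply H, locally_ball. }
  apply (filterlim_locally_unique (V := C_NormedModule) u _ _ HC H).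
Qed.

Lemma Ccv_ext (u v : nat -> C) (l : C) : (forall n, u n = v n) -> Ccv u l -> Ccv v l.
Proof.
  intros E H eps He; destruct (H eps He) as [N HN]; exists N; intros n Hn; rewrite <- E; auto.
Qed.

Lemma Ccv_const (c : C) : Ccv (fun _ => c) c.
Proof.
  intros eps He; exists 0%nat; intros; replace (c - c)%C with (RtoC 0) by ring; rewrite Cmod_0; auto.
Qed.

Lemma Ccv_plus (u v : nat -> C) (a b : C) :
  Ccv u a -> Ccv v b -> Ccv (fun n => u n + v n)%C (a + b)%C.
Proof.
  intros Hu Hv eps He.
  destruct (Hu (eps / 2)) as [N HN]; [lra|]. destruct (Hv (eps / 2)) as [K HK]; [lra|].
  exists (N + K)%nat; intros n Hn.
  replace (u n + v n - (a + b))%C with ((u n - a) + (v n - b))%C by ring.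
  eapply Rle_lt_trans; [apply Cmod_triangle|].
  assert (Cmod (u n - a) < eps / 2) by (apply HN; lia).
  assert (Cmod (v n - b) < eps / 2) by (apply HK; lia). lra.
Qed.

Lemma Ccv_scal (c : C) (u : nat -> C) (a : C) : Ccv u a -> Ccv (fun n => c * u n)%C (c * a)%C.
Proof.
  intros Hu eps He. pose proof (Cmod_ge_0 c).
  destruct (Hu (eps / (Cmod c + 1))) as [N HN]; [apply Rdiv_lt_0_compat; lra|].
  exists N; intros n Hn. replace (c * u n - c * a)%C with (c * (u n - a))%C by ring.
  rewrite Cmod_mult. specialize (HN n Hn). pose proof (Cmod_ge_0 (u n - a)).
  apply Rmult_lt_compat_r with (r := Cmod c + 1) in HN; [|lra].
  replace (eps / (Cmod c + 1) * (Cmod c + 1)) with eps in HN by (field; lra). nra.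
Qed.

Lemma Ccv_shift (u : nat -> C) (l : C) : Ccv (fun n => u (S n)) l <-> Ccv u l.
Proof.
  split; intros H eps He; destruct (H eps He) as [N HN].
  - exists (S N); intros [|n] Hn; [lia|]. apply HN; lia.
  - exists N; intros n Hn; apply HN; lia.
Qed.

Lemma Ccv_Cmod_le (u : nat -> C) (l : C) (B : R) :
  Ccv u l -> (forall n, Cmod (u n) <= B) -> Cmod l <= B.
Proof.
  intros H HB; apply le_epsilon; intros eps He.
  destruct (H eps He) as [N HN]; specialize (HN N (Nat.le_refl N)).
  replace l with (u N + - (u N - l))%C by ring.
  eapply Rle_trans; [apply Cmod_triangle|]. rewrite Cmod_opp. specialize (HB N). lra.
Qed.

Lemma sum_n_0_C (a : nat -> C) : sum_n a 0 = a 0%nat.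
Proof. apply sum_O. Qed.
Lemma sum_n_S_C (a : nat -> C) (n : nat) : sum_n a (S n) = (sum_n a n + a (S n))%C.
Proof. exact (@sum_Sn C_AbelianMonoid a n). Qed.

Lemma sum_n_ext_C (a b : nat -> C) (n : nat) :
  (forall k, (k <= n)%nat -> a k = b k) -> sum_n a n = sum_n b n :> C.
Proof. apply sum_n_ext_loc. Qed.

Lemma sum_n_shift_C (a : nat -> C) (n : nat) :
  (a 0%nat + sum_n (fun k => a (S k)) n)%C = sum_n a (S n).
Proof.
  induction n as [|n IH]; rewrite (sum_n_S_C a).
  - rewrite !sum_n_0_C; reflexivity.
  - rewrite <- IH, (sum_n_S_C (fun k => a (S k))). ring.
Qed.

Lemma sum_n_scal_C (c : C) (a : nat -> C) (n : nat) :
  sum_n (fun k => c * a k)%C n = (c * sum_n a n)%C :> C.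
Proof.
  induction n as [|n IH]; [rewrite !sum_n_0_C; reflexivity|].
  rewrite !sum_n_S_C, IH; ring.
Qed.

Lemma sum_n_plus_C (a b : nat -> C) (n : nat) :
  sum_n (fun k => a k + b k)%C n = (sum_n a n + sum_n b n)%C :> C.
Proof.
  induction n as [|n IH]; [rewrite !sum_n_0_C; reflexivity|].
  rewrite !sum_n_S_C, IH; ring.
Qed.

Lemma Cmod_sum_n_geometric (a : nat -> C) (M : R) : (forall n, Cmod (a n) <= M * (/ 2) ^ n) ->
  forall n, Cmod (sum_n a n) <= 2 * M.
Proof.
  intros H n.
  assert (M0 : 0 <= M) by (specialize (H 0%nat); pose proof (Cmod_ge_0 (a 0%nat)); simpl in H; lra).
  assert (E : Cmod (sum_n a n) <= M * (2 - (/ 2) ^ n)).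
  { induction n as [|n IH].
    - rewrite sum_n_0_C; simpl. specialize (H 0%nat); simpl in H; lra.
    - rewrite sum_n_S_C. eapply Rle_trans; [apply Cmod_plus_le; [apply IH|apply H]|].
      simpl. right; field. }
  pose proof (pow_le (/ 2) n ltac:(lra)). nra.
Qed.

Lemma geometric_series_Ccv (a : nat -> C) (M rho : R) : 0 <= rho < 1 ->
  (forall n, Cmod (a n) <= M * rho ^ n) -> Ccv (sum_n a) (limC (sum_n a)).
Proof.
  intros Hr H.
  assert (X : ex_series (V := C_CompleteNormedModule) a).
  { apply (ex_series_le (V := C_CompleteNormedModule) a (fun n => M * rho ^ n) H).
    apply (ex_series_scal (V := R_NormedModule)), ex_series_geom. rewrite Rabs_pos_eq; lra. }
  destruct X as [l Hl]. apply Ccv_filterlim in Hl.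
  assert (Hl' : Ccv (sum_n a) l) by exact Hl.
  rewrite (Ccv_limC _ _ Hl'); exact Hl'.
Qed.

(** One constant dominates both half-lines, split at -1 as in [sumZ]. The fixed ratio 1/2 suffices
    because Gaussian terms decay faster than any geometric sequence. *)
Definition geomZ (M : R) (f : Z -> C) : Prop := forall n : nat,
  Cmod (f (Z.of_nat n)) <= M * (/ 2) ^ n /\ Cmod (f (- Z.of_nat n - 1)%Z) <= M * (/ 2) ^ n.

Lemma sumZ_ext (f g : Z -> C) : (forall n, f n = g n) -> sumZ f = sumZ g.
Proof.
  intros H; unfold sumZ, limC; f_equal; f_equal; f_equal;
    apply functional_extensionality; intros n; apply sum_n_ext; intros; apply H.
Qed.

Lemma sumZ_unfold (f : Z -> C) (M : R) : geomZ M f -> exists a b : C,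
  Ccv (sum_n (fun n => f (Z.of_nat n))) a /\ Ccv (sum_n (fun n => f (- Z.of_nat n - 1)%Z)) b /\
  sumZ f = (a + b)%C.
Proof.
  intros H; do 2 eexists; split; [|split]; [| |reflexivity];
    apply (geometric_series_Ccv _ M (/ 2)); try lra; intros n; apply H.
Qed.

Lemma sumZ_of_Ccv (f : Z -> C) (a b : C) :
  Ccv (sum_n (fun n => f (Z.of_nat n))) a -> Ccv (sum_n (fun n => f (- Z.of_nat n - 1)%Z)) b ->
  sumZ f = (a + b)%C.
Proof. intros Ha Hb; unfold sumZ; rewrite (Ccv_limC _ _ Ha), (Ccv_limC _ _ Hb); reflexivity. Qed.

Lemma sumZ_scal (c : C) (f : Z -> C) (M : R) : geomZ M f ->
  sumZ (fun n => c * f n)%C = (c * sumZ f)%C.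
Proof.
  intros H; destruct (sumZ_unfold f M H) as (a & b & Ha & Hb & ->).
  rewrite (sumZ_of_Ccv _ (c * a) (c * b)); [ring|..].
  - apply (Ccv_ext (fun n => c * sum_n (fun n => f (Z.of_nat n)) n)%C).
    + intros; rewrite <- sum_n_scal_C; reflexivity.
    + apply Ccv_scal, Ha.
  - apply (Ccv_ext (fun n => c * sum_n (fun n => f (- Z.of_nat n - 1)%Z) n)%C).
    + intros; rewrite <- sum_n_scal_C; reflexivity.
    + apply Ccv_scal, Hb.
Qed.

Lemma sumZ_plus (f g : Z -> C) (M N : R) : geomZ M f -> geomZ N g ->
  sumZ (fun n => f n + g n)%C = (sumZ f + sumZ g)%C.
Proof.
  intros Hf Hg; destruct (sumZ_unfold f M Hf) as (a & b & Ha & Hb & ->).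
  destruct (sumZ_unfold g N Hg) as (a' & b' & Ha' & Hb' & ->).
  rewrite (sumZ_of_Ccv _ (a + a') (b + b')); [ring|..].
  - eapply Ccv_ext; [|apply (Ccv_plus _ _ _ _ Ha Ha')].
    intros; cbv beta; rewrite <- sum_n_plus_C; reflexivity.
  - eapply Ccv_ext; [|apply (Ccv_plus _ _ _ _ Hb Hb')].
    intros; cbv beta; rewrite <- sum_n_plus_C; reflexivity.
Qed.

Lemma geomZ_scal (c : C) (f : Z -> C) (M : R) : geomZ M f -> geomZ (Cmod c * M) (fun n => c * f n)%C.
Proof.
  intros H n; rewrite !Cmod_mult, !Rmult_assoc; destruct (H n).
  split; apply Rmult_le_compat_l; auto; apply Cmod_ge_0.
Qed.

Lemma Cmod_sumZ_le (f : Z -> C) (M : R) : geomZ M f -> Cmod (sumZ f) <= 4 * M.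
Proof.
  intros H; destruct (sumZ_unfold f M H) as (a & b & Ha & Hb & ->).
  replace (4 * M) with (2 * M + 2 * M) by ring. apply Cmod_plus_le.
  - apply (Ccv_Cmod_le _ _ _ Ha), Cmod_sum_n_geometric; intros; apply H.
  - apply (Ccv_Cmod_le _ _ _ Hb), Cmod_sum_n_geometric; intros; apply H.
Qed.

(** The shift moves the single term [f 0] from the nonnegative half to the negative one. *)
Lemma sumZ_shift (f : Z -> C) (M : R) : geomZ M f -> sumZ (fun n => f (n + 1)%Z) = sumZ f.
Proof.
  intros H; destruct (sumZ_unfold f M H) as (a & b & Ha & Hb & ->).
  rewrite (sumZ_of_Ccv _ (- f 0%Z + a) (f 0%Z + b)); [ring|..].
  - apply Ccv_shift in Ha.
    eapply Ccv_ext; [|apply (Ccv_plus _ _ _ _ (Ccv_const (- f 0%Z)) Ha)].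
    intros n; cbv beta; rewrite <- sum_n_shift_C. simpl (Z.of_nat 0).
    rewrite (sum_n_ext _ (fun k => f (Z.of_nat k + 1)%Z)); [ring|].
    intros; f_equal; lia.
  - apply (proj1 (Ccv_shift _ _)).
    eapply Ccv_ext; [|apply (Ccv_plus _ _ _ _ (Ccv_const (f 0%Z)) Hb)].
    intros n; cbv beta; rewrite <- sum_n_shift_C. simpl (- Z.of_nat 0 - 1 + 1)%Z.
    rewrite (sum_n_ext _ (fun k => f (- Z.of_nat (S k) - 1 + 1)%Z)); [reflexivity|].
    intros; f_equal; lia.
Qed.

Lemma half_C : RtoC (/ 2) = (/ 2)%C.
Proof. apply RtoC_inv; lra. Qed.

Ltac pushC := rewrite ?plus_IZR, ?minus_IZR, ?opp_IZR, ?mult_IZR;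
  repeat rewrite ?RtoC_plus, ?RtoC_minus, ?RtoC_mult, ?RtoC_opp, ?RtoC_pow, ?half_C.

(** * The odd theta function and its quasi-periods *)

Definition half_shift (n : Z) : R := IZR n + / 2.

(** The general term of the theta function with both characteristics 1/2, the odd one, normalised to
    the quasi-periods 1 and [tau]. *)
Definition theta_term (tau : C) (n : Z) (z : C) : C :=
  ee (RtoC (/ 2 * half_shift n ^ 2) * tau + RtoC (half_shift n) * (z + RtoC (/ 2)))%C.

Definition jtheta (tau z : C) : C := sumZ (fun n => theta_term tau n z).

Definition jtheta' (tau z : C) : C :=
  sumZ (fun n => RtoC (2 * PI) * Ci * (half_shift n * theta_term tau n z))%C.

(** Majorant of the theta terms for bounded [z]. The free parameter [B] absorbs the dependence on
    [z] and, when enlarged, every polynomial factor in [half_shift n] that differentiation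
    produces. *)
Definition gauss (y B : R) (n : Z) : R :=
  exp (- (PI * y * half_shift n ^ 2) + B * Rabs (half_shift n)).

Lemma exp_opp_nat_le (n : nat) : exp (- INR n) <= (/ 2) ^ n.
Proof.
  induction n as [|n IH]; [simpl; rewrite Ropp_0, exp_0; lra|].
  rewrite S_INR, Ropp_plus_distr, exp_plus. simpl. rewrite Rmult_comm.
  assert (exp (- (1)) <= / 2).
  { rewrite exp_Ropp. pose proof (exp_ineq1 1 ltac:(lra)). apply Rinv_le_contravar; lra. }
  apply Rmult_le_compat; auto; left; apply exp_pos.
Qed.

(** Completing the square in [PI y m^2 - (B + 1) m] gives the constant; the extra 1 in [B + 1] pays
    for the factor [exp (- m)], which is at most [exp (- n)]. *)
Lemma gauss_bound_aux (y B : R) (n : nat) (k : Z) : 0 < y ->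
  Rabs (half_shift k) = INR n + / 2 ->
  gauss y B k <= exp ((B + 1) ^ 2 / (4 * (PI * y))) * (/ 2) ^ n.
Proof.
  intros Hy Hk; unfold gauss. pose proof PI_RGT_0.
  rewrite <- (pow2_abs (half_shift k)), Hk. set (m := INR n + / 2).
  assert (P : 0 < PI * y) by nra.
  eapply Rle_trans; [apply exp_le with (y := (B + 1) ^ 2 / (4 * (PI * y)) + - INR n)|].
  - assert (E : 0 <= PI * y * (m - (B + 1) / (2 * (PI * y))) ^ 2)
      by (apply Rmult_le_pos; [lra|apply pow2_ge_0]).
    replace (PI * y * (m - (B + 1) / (2 * (PI * y))) ^ 2)
      with (PI * y * m ^ 2 - (B + 1) * m + (B + 1) ^ 2 / (4 * (PI * y))) in E by (field; lra).
    unfold m in *; lra.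
  - rewrite exp_plus. apply Rmult_le_compat_l; [left; apply exp_pos|apply exp_opp_nat_le].
Qed.

Lemma gauss_bound (y B : R) : 0 < y -> exists K, 0 < K /\ forall n : nat,
  gauss y B (Z.of_nat n) <= K * (/ 2) ^ n /\ gauss y B (- Z.of_nat n - 1) <= K * (/ 2) ^ n.
Proof.
  intros Hy; exists (exp ((B + 1) ^ 2 / (4 * (PI * y)))); split; [apply exp_pos|].
  intros n; pose proof (pos_INR n); split; apply gauss_bound_aux; auto; unfold half_shift.
  - rewrite <- INR_IZR_INZ, Rabs_pos_eq; lra.
  - rewrite minus_IZR, opp_IZR, <- INR_IZR_INZ, Rabs_left; lra.
Qed.

Lemma geomZ_of_gauss (y B L : R) (f : Z -> C) : 0 < y -> 0 <= L ->
  (forall n, Cmod (f n) <= L * gauss y B n) ->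
  geomZ (L * exp ((B + 1) ^ 2 / (4 * (PI * y)))) f.
Proof.
  intros Hy HL H n; pose proof (pos_INR n); split;
    (eapply Rle_trans; [apply H|]); rewrite Rmult_assoc; apply Rmult_le_compat_l; auto;
    apply gauss_bound_aux; auto; unfold half_shift.
  - rewrite <- INR_IZR_INZ, Rabs_pos_eq; lra.
  - rewrite minus_IZR, opp_IZR, <- INR_IZR_INZ, Rabs_left; lra.
Qed.

Lemma gauss_le (y B B' : R) (n : Z) : B <= B' -> gauss y B n <= gauss y B' n.
Proof. intros; unfold gauss; apply exp_le. pose proof (Rabs_pos (half_shift n)); nra. Qed.

Lemma Cmod_theta_term_le (tau z : C) (n : Z) (r : R) : Cmod z <= r ->
  Cmod (theta_term tau n z) <= gauss (Im tau) (2 * PI * r) n.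
Proof.
  intros Hz; unfold theta_term, gauss; rewrite Cmod_ee; apply exp_le.
  set (m := half_shift n). destruct tau as [x y], z as [u v]; simpl.
  pose proof (Rabs_Im_le (u, v)) as H; simpl in H.
  assert (E : - (m * v) <= Rabs m * r).
  { eapply Rle_trans; [apply Rle_abs|]. rewrite Rabs_Ropp, Rabs_mult.
    apply Rmult_le_compat_l; [apply Rabs_pos|lra]. }
  pose proof PI_RGT_0.
  replace (- (2 * PI * (/ 2 * (m * (m * 1)) * y + 0 * x + (m * (v + 0) + 0 * (u + / 2)))))
    with (- (PI * y * (m * (m * 1))) + 2 * PI * - (m * v)) by field.
  nra.
Qed.

Lemma Rabs_half_shift_le (n : Z) : 2 * PI * Rabs (half_shift n) <= exp (2 * PI * Rabs (half_shift n)).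
Proof. pose proof (exp_ineq1_le (2 * PI * Rabs (half_shift n))). lra. Qed.

Lemma Cmod_two_pi_Ci (x : R) : Cmod (RtoC (2 * PI) * Ci * x)%C = 2 * PI * Rabs x.
Proof.
  rewrite !Cmod_mult, !Cmod_R. pose proof PI_RGT_0. rewrite Rabs_pos_eq by lra.
  replace (Cmod Ci) with 1; [ring|]. unfold Cmod; simpl.
  replace (0 * (0 * 1) + 1 * (1 * 1)) with 1 by ring. symmetry; apply sqrt_1.
Qed.

(** The shift by [h] multiplies the term by [cexp w] with [w = 2 PI i m h]. In [B], the term itself
    costs [2 PI r], the factor [exp |w|] another [2 PI r], and [(2 PI |m|)^2] is absorbed by
    [exp (4 PI |m|)]. *)
Lemma theta_term_differential (tau z h : C) (n : Z) (r : R) : Cmod z <= r -> Cmod h <= r ->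
  let B := 4 * PI * r + 4 * PI in
  Cmod (theta_term tau n z) <= gauss (Im tau) B n /\
  Cmod (RtoC (2 * PI) * Ci * (half_shift n * theta_term tau n z))%C <= gauss (Im tau) B n /\
  Cmod (theta_term tau n (z + h) - theta_term tau n z
        - h * (RtoC (2 * PI) * Ci * (half_shift n * theta_term tau n z)))%C
    <= 8 * Cmod h ^ 2 * gauss (Im tau) B n.
Proof.
  intros Hz Hh B. set (m := half_shift n).
  pose proof (Cmod_theta_term_le tau z n r Hz) as T.
  pose proof (Rabs_half_shift_le n) as E1; fold m in E1.
  pose proof PI_RGT_0; pose proof (Cmod_ge_0 z); pose proof (Cmod_ge_0 h);
    pose proof (Rabs_pos m) as Pm.
  pose proof (Cmod_ge_0 (theta_term tau n z)).
  assert (0 <= PI * r) by nra.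
  assert (G : forall k, gauss (Im tau) (2 * PI * r) n * exp (k * Rabs m)
                        = gauss (Im tau) (2 * PI * r + k) n).
  { intros k; unfold gauss; rewrite <- exp_plus; f_equal; fold m; ring. }
  split; [|split].
  - eapply Rle_trans; [exact T|]. apply gauss_le; unfold B; lra.
  - rewrite Cmult_assoc, Cmod_mult, Cmod_two_pi_Ci.
    eapply Rle_trans; [apply Rmult_le_compat; [|auto|exact E1|exact T]|].
    + nra.
    + rewrite Rmult_comm, G. apply gauss_le; unfold B; lra.
  - set (w := (RtoC (2 * PI) * Ci * m * h)%C).
    assert (Ew : theta_term tau n (z + h) = (theta_term tau n z * cexp w)%C).
    { unfold theta_term. fold m.
      replace (cexp w) with (ee (m * h)) by (unfold ee, w; f_equal; ring).
      rewrite <- ee_plus; f_equal; ring. }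
    rewrite Ew.
    replace (theta_term tau n z * cexp w - theta_term tau n z
             - h * (RtoC (2 * PI) * Ci * (m * theta_term tau n z)))%C
      with (theta_term tau n z * (cexp w - 1 - w))%C by (unfold w; ring).
    assert (Cw : Cmod w = 2 * PI * Rabs m * Cmod h) by (unfold w; rewrite Cmod_mult, Cmod_two_pi_Ci; ring).
    eapply Rle_trans; [apply Cmod_mult_le; [exact T|apply Cmod_cexp_sub]|].
    rewrite Cw.
    assert (E2 : (2 * PI * Rabs m) ^ 2 <= exp (4 * PI * Rabs m)).
    { replace (4 * PI * Rabs m) with (2 * PI * Rabs m + 2 * PI * Rabs m) by ring.
      rewrite exp_plus. simpl; rewrite Rmult_1_r. apply Rmult_le_compat; nra. }
    assert (E3 : exp (2 * PI * Rabs m * Cmod h) <= exp (2 * PI * r * Rabs m)).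
    { apply exp_le. assert (0 <= PI * Rabs m) by nra. nra. }
    replace (B) with (2 * PI * r + (4 * PI + 2 * PI * r)) by (unfold B; ring).
    rewrite <- G. replace ((4 * PI + 2 * PI * r) * Rabs m)
      with (4 * PI * Rabs m + 2 * PI * r * Rabs m) by ring.
    rewrite exp_plus.
    replace (gauss (Im tau) (2 * PI * r) n *
      (8 * (2 * PI * Rabs m * Cmod h) ^ 2 * exp (2 * PI * Rabs m * Cmod h)))
      with (8 * Cmod h ^ 2 * (gauss (Im tau) (2 * PI * r) n *
        ((2 * PI * Rabs m) ^ 2 * exp (2 * PI * Rabs m * Cmod h)))) by ring.
    apply Rmult_le_compat_l; [pose proof (pow2_ge_0 (Cmod h)); lra|].
    apply Rmult_le_compat_l; [unfold gauss; left; apply exp_pos|].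
    apply Rmult_le_compat; auto; [apply pow2_ge_0|left; apply exp_pos].
Qed.

Lemma geomZ_theta_term (tau z : C) : upper_half tau ->
  exists M, geomZ M (fun n => theta_term tau n z).
Proof.
  intros Ht; eexists; apply (geomZ_of_gauss (Im tau) (2 * PI * Cmod z) 1); [exact Ht|lra|].
  intros n; rewrite Rmult_1_l; apply Cmod_theta_term_le, Rle_refl.
Qed.

Lemma cdiff_jtheta (tau : C) : upper_half tau -> cdiff (jtheta tau) (jtheta' tau).
Proof.
  intros Ht r. set (B := 4 * PI * r + 4 * PI).
  set (K := exp ((B + 1) ^ 2 / (4 * (PI * Im tau)))).
  assert (PK : 0 < K) by apply exp_pos.
  (* 32 is the 8 of the termwise remainder times the 4 of the two-sided geometric sum. *)
  exists (32 * K); intros z h Hz Hh. pose proof (Cmod_ge_0 h).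
  assert (Q := fun n => theta_term_differential tau z h n r Hz Hh). cbv zeta in Q; fold B in Q.
  assert (G1 : geomZ (1 * K) (fun n => theta_term tau n z)).
  { apply geomZ_of_gauss; [exact Ht|lra|]. intros n; rewrite Rmult_1_l; apply Q. }
  assert (G2 : geomZ (1 * K) (fun n => RtoC (2 * PI) * Ci * (half_shift n * theta_term tau n z))%C).
  { apply geomZ_of_gauss; [exact Ht|lra|]. intros n; rewrite Rmult_1_l; apply Q. }
  assert (G3 : geomZ (8 * Cmod h ^ 2 * K) (fun n => theta_term tau n (z + h) - theta_term tau n z
        - h * (RtoC (2 * PI) * Ci * (half_shift n * theta_term tau n z)))%C).
  { apply geomZ_of_gauss; [exact Ht|nra|]. intros n; apply Q. }
  split; [|split].
  - eapply Rle_trans; [apply Cmod_sumZ_le, G1|lra].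
  - eapply Rle_trans; [apply Cmod_sumZ_le, G2|lra].
  - replace (jtheta tau (z + h) - jtheta tau z - h * jtheta' tau z)%C
      with (sumZ (fun n => theta_term tau n (z + h) - theta_term tau n z
        - h * (RtoC (2 * PI) * Ci * (half_shift n * theta_term tau n z)))%C).
    + eapply Rle_trans; [apply Cmod_sumZ_le, G3|right; ring].
    + destruct (geomZ_theta_term tau (z + h) Ht) as [M0 G0].
      rewrite (sumZ_ext _ (fun n => theta_term tau n (z + h) + (- (1) * theta_term tau n z
        + - h * (RtoC (2 * PI) * Ci * (half_shift n * theta_term tau n z))))%C) by (intros; ring).
      pose proof (geomZ_scal (- (1)) _ _ G1) as G1'.
      pose proof (geomZ_scal (- h) _ _ G2) as G2'. cbv beta in G1', G2'.
      assert (G12 : geomZ (Cmod (- (1)) * (1 * K) + Cmod (- h) * (1 * K))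
        (fun n => - (1) * theta_term tau n z
        + - h * (RtoC (2 * PI) * Ci * (half_shift n * theta_term tau n z)))%C).
      { intros n; destruct (G1' n), (G2' n); rewrite Rmult_plus_distr_r;
          split; apply Cmod_plus_le; assumption. }
      rewrite (sumZ_plus _ _ _ _ G0 G12), (sumZ_plus _ _ _ _ G1' G2'),
        (sumZ_scal _ _ _ G1), (sumZ_scal _ _ _ G2).
      unfold jtheta, jtheta'; ring.
Qed.

Lemma jtheta_plus_1 (tau z : C) : upper_half tau -> jtheta tau (z + 1) = (- jtheta tau z)%C.
Proof.
  intros Ht; destruct (geomZ_theta_term tau z Ht) as [M HM]. unfold jtheta.
  rewrite (sumZ_ext _ (fun n => - (1) * theta_term tau n z)%C).
  - rewrite (sumZ_scal _ _ _ HM); ring.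
  - intros n; unfold theta_term, half_shift.
    transitivity (ee (RtoC (/ 2 * (IZR n + / 2) ^ 2) * tau + RtoC (IZR n + / 2) * (z + RtoC (/ 2))
                      + RtoC (/ 2) + RtoC (IZR n))).
    + f_equal. pushC. ring.
    + rewrite ee_plus_Z, ee_plus, ee_half; ring.
Qed.

(** Completing the square turns the shift of [z] by [tau] into the index shift [n -> n + 1]; the
    sign comes from the [1/2] added to [z]. *)
Lemma jtheta_plus_tau (tau z : C) : upper_half tau ->
  jtheta tau (z + tau) = (- (ee (- (tau * RtoC (/ 2)) - z) * jtheta tau z))%C.
Proof.
  intros Ht; destruct (geomZ_theta_term tau z Ht) as [M HM]. unfold jtheta.
  rewrite <- (sumZ_shift _ M HM).
  rewrite (sumZ_ext _ (fun n => - ee (- (tau * RtoC (/ 2)) - z) * theta_term tau (n + 1) z)%C).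
  - rewrite (sumZ_shift (fun n => - ee (- (tau * RtoC (/ 2)) - z) * theta_term tau n z)%C _
      (geomZ_scal _ _ _ HM)).
    rewrite (sumZ_scal _ _ _ HM), (sumZ_shift _ _ HM); ring.
  - intros n. transitivity (ee (RtoC (/ 2)) * (ee (- (tau * RtoC (/ 2)) - z) * theta_term tau (n + 1) z))%C.
    + unfold theta_term, half_shift. rewrite <- !ee_plus. apply ee_eq_mod_Z with (-1)%Z.
      pushC. field.
    + rewrite ee_half; ring.
Qed.

(** The sign [(-1)^n] is written as [ee (n / 2)], so that later comparisons of factors become
    comparisons of exponents modulo integers. *)
Lemma jtheta_plus_Z (tau z : C) (n : Z) : upper_half tau ->
  jtheta tau (z + RtoC (IZR n)) = (ee (RtoC (IZR n) * RtoC (/ 2)) * jtheta tau z)%C.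
Proof.
  intros Ht; revert n. apply Z.peano_ind.
  - rewrite Cmult_0_l, ee_0, Cplus_0_r; ring.
  - intros n IH. unfold Z.succ; rewrite plus_IZR, RtoC_plus, Cplus_assoc, jtheta_plus_1, IH by auto.
    rewrite Cmult_plus_distr_r, ee_plus, Cmult_1_l, ee_half; ring.
  - intros n IH. unfold Z.pred. rewrite plus_IZR, RtoC_plus.
    replace (z + RtoC (IZR n))%C with (z + (IZR n + RtoC (IZR (-1))) + 1)%C in IH by (simpl; ring).
    rewrite jtheta_plus_1 in IH by auto.
    replace (RtoC (IZR n) * RtoC (/ 2))%C
      with ((RtoC (IZR n) + RtoC (IZR (-1))) * RtoC (/ 2) + RtoC (/ 2))%C in IH by (simpl; ring).
    rewrite ee_plus, ee_half in IH.
    replace (jtheta tau (z + (IZR n + RtoC (IZR (-1)))))%C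
      with (- - jtheta tau (z + (IZR n + RtoC (IZR (-1)))))%C by ring. rewrite IH; ring.
Qed.

Lemma jtheta_plus_Z_tau (tau z : C) (m : Z) : upper_half tau ->
  jtheta tau (z + RtoC (IZR m) * tau)
  = (ee (RtoC (IZR m) * RtoC (/ 2) - RtoC (IZR m) ^ 2 * RtoC (/ 2) * tau - RtoC (IZR m) * z)
     * jtheta tau z)%C.
Proof.
  intros Ht; revert m. apply Z.peano_ind.
  - replace (RtoC 0 * RtoC (/ 2) - RtoC 0 ^ 2 * RtoC (/ 2) * tau - RtoC 0 * z)%C with (RtoC 0) by ring.
    rewrite Cmult_0_l, ee_0, Cplus_0_r; ring.
  - intros n IH. unfold Z.succ.
    replace (z + RtoC (IZR (n + 1)) * tau)%C with (z + RtoC (IZR n) * tau + tau)%C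
      by (rewrite plus_IZR, RtoC_plus; ring).
    rewrite jtheta_plus_tau, IH by auto.
    transitivity (ee (RtoC (/ 2)) * (ee (- (tau * RtoC (/ 2)) - (z + RtoC (IZR n) * tau)) *
      (ee (RtoC (IZR n) * RtoC (/ 2) - RtoC (IZR n) ^ 2 * RtoC (/ 2) * tau - RtoC (IZR n) * z)
       * jtheta tau z)))%C; [rewrite ee_half; ring|].
    rewrite !Cmult_assoc, <- !ee_plus. f_equal; f_equal. pushC. field.
  - intros n IH. unfold Z.pred.
    set (w := (z + RtoC (IZR (n + -1)) * tau)%C).
    replace (z + RtoC (IZR n) * tau)%C with (w + tau)%C in IH
      by (unfold w; rewrite plus_IZR, RtoC_plus; ring).
    rewrite jtheta_plus_tau in IH by auto.
    pose proof (ee_opp (- (tau * RtoC (/ 2)) - w)) as O.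
    set (u := ee (- (tau * RtoC (/ 2)) - w)) in *.
    transitivity (- ee (- (- (tau * RtoC (/ 2)) - w)) * - (u * jtheta tau w))%C.
    { transitivity (ee (- (- (tau * RtoC (/ 2)) - w)) * u * jtheta tau w)%C; [rewrite O; ring|ring]. }
    rewrite IH.
    transitivity (ee (RtoC (/ 2)) * (ee (- (- (tau * RtoC (/ 2)) - w)) *
      (ee (RtoC (IZR n) * RtoC (/ 2) - RtoC (IZR n) ^ 2 * RtoC (/ 2) * tau - RtoC (IZR n) * z)
       * jtheta tau z)))%C; [rewrite ee_half; ring|].
    rewrite !Cmult_assoc, <- !ee_plus. f_equal; unfold w. apply ee_eq_mod_Z with 1%Z.
    pushC. field.
Qed.

(** * The Euler product *)

(** The q-Pochhammer symbol (q; q)_n. *)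
Fixpoint qpoch (q : C) (n : nat) : C :=
  match n with O => 1%C | S k => (qpoch q k * (1 - q ^ S k))%C end.

Lemma eta_pprod_qpoch (tau : C) (n : nat) : eta_pprod tau n = qpoch (ee tau) n.
Proof.
  induction n as [|n IH]; [reflexivity|].
  cbn [eta_pprod qpoch]. rewrite IH, ee_nat_mul; reflexivity.
Qed.

Lemma Cmod_Cpow (q : C) (n : nat) : Cmod (q ^ n) = Cmod q ^ n.
Proof. induction n as [|n IH]; simpl; [apply Cmod_1|]. rewrite Cmod_mult, IH; reflexivity. Qed.

Lemma Cmod_qpoch_le (q : C) (n : nat) : Cmod q < 1 -> Cmod (qpoch q n) <= exp (/ (1 - Cmod q)).
Proof.
  intros Hq; set (r := Cmod q) in *. assert (Pr : 0 <= r) by apply Cmod_ge_0.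
  assert (E : Cmod (qpoch q n) <= exp ((1 - r ^ S n) * / (1 - r))).
  { induction n as [|n IH].
    - simpl qpoch. rewrite Cmod_1. apply Rle_trans with (exp 0); [rewrite exp_0; lra|apply exp_le].
      apply Rmult_le_pos; [simpl; lra|left; apply Rinv_0_lt_compat; lra].
    - cbn [qpoch]. eapply Rle_trans; [apply Cmod_mult_le with (b := exp (r ^ S n)); [exact IH|]|].
      + eapply Rle_trans; [apply Cmod_triangle|]. rewrite Cmod_1, Cmod_opp, Cmod_Cpow.
        apply exp_ineq1_le.
      + rewrite <- exp_plus; right; f_equal. cbn [pow]. field; lra. }
  eapply Rle_trans; [exact E|]. apply exp_le.
  assert (0 < / (1 - r)) by (apply Rinv_0_lt_compat; lra).
  pose proof (pow_le r (S n) Pr). nra.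
Qed.

(** For [0 <= x <= r] one has [1 - x >= exp (- x / (1 - r))], and the exponents add up to a
    geometric sum; the partial sum in [E] is what the induction carries. A bound uniform in [n]
    keeps the infinite product away from 0 and bounds the inverses. *)
Lemma Cmod_qpoch_ge (q : C) (n : nat) : Cmod q < 1 ->
  exp (- (/ (1 - Cmod q) * / (1 - Cmod q))) <= Cmod (qpoch q n).
Proof.
  intros Hq; set (r := Cmod q) in *. assert (Pr : 0 <= r) by apply Cmod_ge_0.
  assert (Pi : 0 < / (1 - r)) by (apply Rinv_0_lt_compat; lra).
  assert (E : exp (- ((1 - r ^ S n) * / (1 - r) * / (1 - r))) <= Cmod (qpoch q n)).
  { induction n as [|n IH].
    - simpl qpoch. rewrite Cmod_1. apply Rle_trans with (exp 0); [apply exp_le|rewrite exp_0; lra].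
      enough (0 <= (1 - r ^ 1) * / (1 - r) * / (1 - r)) by lra.
      apply Rmult_le_pos; [|lra]. apply Rmult_le_pos; simpl; lra.
    - cbn [qpoch]. rewrite Cmod_mult.
      set (x := r ^ S n) in *.
      assert (X : 0 <= x <= r).
      { split; [apply pow_le, Pr|]. unfold x; simpl.
        rewrite <- (Rmult_1_r r) at 3. apply Rmult_le_compat_l; [auto|].
        rewrite <- (pow1 n). apply pow_incr; lra. }
      assert (Q1 : 1 - x <= Cmod (1 - q ^ S n)).
      { pose proof (Cmod_triangle (1 - q ^ S n) (q ^ S n)) as Tr.
        replace (1 - q ^ S n + q ^ S n)%C with (RtoC 1) in Tr by ring.
        rewrite Cmod_1, Cmod_Cpow in Tr. fold r in Tr. fold x in Tr. lra. }
      assert (Q2 : exp (- (x * / (1 - r))) <= 1 - x).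
      { rewrite exp_Ropp. pose proof (exp_ineq1_le (x * / (1 - r))) as L.
        rewrite <- (Rinv_inv (1 - x)). apply Rinv_le_contravar; [apply Rinv_0_lt_compat; lra|].
        eapply Rle_trans; [|exact L].
        replace (/ (1 - x)) with (1 + x * / (1 - x)) by (field; lra).
        apply Rplus_le_compat_l, Rmult_le_compat_l; [lra|]. apply Rinv_le_contravar; lra. }
      eapply Rle_trans; [|apply Rmult_le_compat; [left; apply exp_pos|left; apply exp_pos|exact IH|]].
      + rewrite <- exp_plus. right; f_equal. change (r ^ S (S n)) with (r * x).
        instantiate (1 := - (x * / (1 - r))). field; lra.
      + lra. }
  eapply Rle_trans; [|exact E]. apply exp_le.
  pose proof (pow_le r (S n) Pr).
  enough ((1 - r ^ S n) * (/ (1 - r) * / (1 - r)) <= 1 * (/ (1 - r) * / (1 - r))) by lra.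
  apply Rmult_le_compat_r; [nra|lra].
Qed.

Lemma qpoch_neq_0 (q : C) (n : nat) : Cmod q < 1 -> qpoch q n <> 0%C.
Proof.
  intros Hq; apply Cmod_gt_0. eapply Rlt_le_trans; [apply exp_pos|apply (Cmod_qpoch_ge q n Hq)].
Qed.

(** The partial products are the partial sums of their increments [- qpoch q k * q^(k+1)], which
    decay geometrically. *)
Lemma qpoch_Ccv (q : C) : Cmod q < 1 -> Ccv (qpoch q) (limC (qpoch q)) /\ limC (qpoch q) <> 0%C.
Proof.
  intros Hq.
  set (a := fun n => match n with O => RtoC 1 | S k => (- qpoch q k * q ^ S k)%C end).
  assert (E : forall n, sum_n a n = qpoch q n :> C).
  { induction n as [|n IH]; [rewrite sum_n_0_C; reflexivity|].
    rewrite sum_n_S_C, IH. cbn [qpoch a]. ring. }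
  assert (X : Ccv (sum_n a) (limC (sum_n a))).
  { apply (geometric_series_Ccv a (exp (/ (1 - Cmod q))) (Cmod q)).
    - split; [apply Cmod_ge_0|exact Hq].
    - intros [|n]; unfold a.
      + rewrite Cmod_1; simpl. rewrite Rmult_1_r.
        apply Rle_trans with (exp 0); [rewrite exp_0; lra|apply exp_le].
        left; apply Rinv_0_lt_compat; lra.
      + apply Cmod_mult_le; [rewrite Cmod_opp; apply Cmod_qpoch_le, Hq|rewrite Cmod_Cpow; apply Rle_refl]. }
  apply (Ccv_ext _ (qpoch q)) in X; [|exact E].
  rewrite (Ccv_limC _ _ X). split; [exact X|]. intros Z; rewrite Z in X.
  destruct (X (exp (- (/ (1 - Cmod q) * / (1 - Cmod q)))) (exp_pos _)) as [N HN].
  specialize (HN N (Nat.le_refl N)). pose proof (Cmod_qpoch_ge q N Hq).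
  replace (qpoch q N - 0)%C with (qpoch q N) in HN by ring. lra.
Qed.

(** * Limits of products, inverses and dominated sums *)

Lemma Ccv_subseq (u : nat -> C) (l : C) (f : nat -> nat) : Ccv u l ->
  (forall K, exists N, forall n, (N <= n)%nat -> (K <= f n)%nat) -> Ccv (fun n => u (f n)) l.
Proof.
  intros H Hf eps He; destruct (H eps He) as [K HK]; destruct (Hf K) as [N HN].
  exists N; intros n Hn; apply HK, HN, Hn.
Qed.

Lemma Ccv_mult (u v : nat -> C) (a b : C) (M : R) : (forall n, Cmod (u n) <= M) ->
  Ccv u a -> Ccv v b -> Ccv (fun n => u n * v n)%C (a * b)%C.
Proof.
  intros HM Hu Hv eps He.
  assert (PM : 0 <= M) by (specialize (HM 0%nat); pose proof (Cmod_ge_0 (u 0%nat)); lra).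
  pose proof (Cmod_ge_0 b) as Pb.
  destruct (Hu (eps / (2 * (Cmod b + 1)))) as [N HN]; [apply Rdiv_lt_0_compat; lra|].
  destruct (Hv (eps / (2 * (M + 1)))) as [K HK]; [apply Rdiv_lt_0_compat; lra|].
  exists (N + K)%nat; intros n Hn.
  specialize (HN n ltac:(lia)); specialize (HK n ltac:(lia)).
  replace (u n * v n - a * b)%C with (u n * (v n - b) + (u n - a) * b)%C by ring.
  eapply Rle_lt_trans; [apply Cmod_triangle|]. rewrite !Cmod_mult.
  specialize (HM n). pose proof (Cmod_ge_0 (u n)).
  pose proof (Cmod_ge_0 (v n - b)); pose proof (Cmod_ge_0 (u n - a)).
  apply Rmult_lt_compat_r with (r := M + 1) in HK; [|lra].
  apply Rmult_lt_compat_r with (r := Cmod b + 1) in HN; [|lra].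
  replace (eps / (2 * (M + 1)) * (M + 1)) with (eps / 2) in HK by (field; lra).
  replace (eps / (2 * (Cmod b + 1)) * (Cmod b + 1)) with (eps / 2) in HN by (field; lra).
  nra.
Qed.

Lemma Ccv_inv (u : nat -> C) (a : C) (d : R) : 0 < d -> (forall n, d <= Cmod (u n)) ->
  a <> 0%C -> Ccv u a -> Ccv (fun n => / u n)%C (/ a)%C.
Proof.
  intros Hd HM Ha Hu eps He. assert (Pa : 0 < Cmod a) by (apply Cmod_gt_0; auto).
  destruct (Hu (eps * (d * Cmod a))) as [N HN]; [repeat apply Rmult_lt_0_compat; auto|].
  exists N; intros n Hn; specialize (HN n Hn); specialize (HM n).
  assert (u n <> 0%C) by (apply Cmod_gt_0; lra).
  replace (/ u n - / a)%C with (- (u n - a) * / (u n * a))%C by (field; auto).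
  rewrite Cmod_mult, Cmod_opp, Cmod_inv, Cmod_mult by (apply Cmult_neq_0; auto).
  apply Rmult_lt_reg_r with (Cmod (u n) * Cmod a); [apply Rmult_lt_0_compat; lra|].
  rewrite Rmult_assoc, Rinv_l, Rmult_1_r by (apply Rgt_not_eq, Rmult_lt_0_compat; lra).
  eapply Rlt_le_trans; [exact HN|]. apply Rmult_le_compat_l; [lra|].
  apply Rmult_le_compat_r; lra.
Qed.

(** Dominated convergence for sums whose upper limit moves with the parameter: beyond a fixed [k]
    the tail is at most [M / 2^k], and the head has finitely many terms. *)
Lemma tannery (f : nat -> nat -> C) (M : R) : (forall N n, Cmod (f N n) <= M * (/ 2) ^ n) ->
  (forall n, Ccv (fun N => f N n) 0) -> Ccv (fun N => sum_n (f N) N) 0.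
Proof.
  intros HM H0 eps He.
  assert (PM : 0 <= M).
  { specialize (HM 0%nat 0%nat); pose proof (Cmod_ge_0 (f 0%nat 0%nat)); simpl in HM; lra. }
  assert (Fin : forall k, Ccv (fun N => sum_n (f N) k) 0).
  { induction k as [|k IH].
    - eapply Ccv_ext; [|apply (H0 0%nat)]. intros; symmetry; apply sum_n_0_C.
    - replace (RtoC 0) with (0 + 0)%C by ring.
      eapply Ccv_ext; [|apply (Ccv_plus _ _ _ _ IH (H0 (S k)))].
      intros; symmetry; apply sum_n_S_C. }
  assert (Tail : forall N k j, Cmod (sum_n (f N) (k + j))
            <= Cmod (sum_n (f N) k) + M * ((/ 2) ^ k - (/ 2) ^ (k + j))).
  { intros N k; induction j as [|j IH].
    - rewrite Nat.add_0_r; lra.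
    - rewrite Nat.add_succ_r, sum_n_S_C.
      eapply Rle_trans; [apply Cmod_plus_le; [exact IH|apply HM]|]. cbn [pow]. lra. }
  destruct (pow_lt_1_zero (/ 2) ltac:(rewrite Rabs_pos_eq; lra) (eps / (2 * (M + 1)))
    ltac:(apply Rdiv_lt_0_compat; lra)) as [k Hk].
  specialize (Hk k (le_n k)). rewrite Rabs_pos_eq in Hk by (apply pow_le; lra).
  apply Rmult_lt_compat_r with (r := M + 1) in Hk; [|lra].
  replace (eps / (2 * (M + 1)) * (M + 1)) with (eps / 2) in Hk by (field; lra).
  destruct (Fin k (eps / 2)) as [N1 HN1]; [lra|].
  exists (N1 + k)%nat; intros n Hn. specialize (HN1 n ltac:(lia)).
  specialize (Tail n k (n - k)%nat). replace (k + (n - k))%nat with n in Tail by lia.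
  assert (S0 : forall w : C, (w - 0)%C = w) by (intros; ring).
  rewrite S0; rewrite S0 in HN1.
  pose proof (pow_le (/ 2) n ltac:(lra)). pose proof (pow_le (/ 2) k ltac:(lra)). nra.
Qed.

(** * Jacobi's derivative formula *)

(* Coefficients of the finite Jacobi product
   (x^(1/2) - x^(-1/2)) prod_(k=1)^N (1 - q^k x) (1 - q^k / x)
     = sum_n bcoef q N n (x^(n+1/2) - x^(-n-1/2)),
   antisymmetry being encoded by [prev]: the coefficient of index -1 is minus that of index 0. *)
Definition prev (u : nat -> C) (n : nat) : C :=
  match n with O => (- u 0%nat)%C | S m => u m end.

Fixpoint bcoef (q : C) (N n : nat) : C :=
  match N with
  | O => match n with O => 1%C | S _ => 0%C end
  | S M => ((1 + q ^ (2 * S M)) * bcoef q M n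
            - q ^ S M * (prev (bcoef q M) n + bcoef q M (S n)))%C
  end.

Lemma bcoef_S (q : C) (M n : nat) :
  bcoef q (S M) n = ((1 + q ^ (2 * S M)) * bcoef q M n
            - q ^ S M * (prev (bcoef q M) n + bcoef q M (S n)))%C.
Proof. reflexivity. Qed.

Lemma bcoef_gt (q : C) (N n : nat) : (N < n)%nat -> bcoef q N n = 0%C.
Proof.
  revert n; induction N as [|N IH]; intros n Hn.
  - destruct n; [lia|reflexivity].
  - rewrite bcoef_S, !IH by lia. destruct n; [lia|]. unfold prev. rewrite IH by lia. ring.
Qed.

(** The derivative of [x^(n+1/2) - x^(-n-1/2)] at [x = 1]. *)
Definition odd_wt (n : nat) : C := RtoC (2 * INR n + 1).

Lemma odd_wt_S (n : nat) : odd_wt (S n) = (odd_wt n + 2)%C.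
Proof. unfold odd_wt; rewrite S_INR, <- RtoC_plus; f_equal; ring. Qed.

Lemma odd_wt_0 : odd_wt 0 = 1%C.
Proof. unfold odd_wt; f_equal; simpl; ring. Qed.

(** Summation by parts: the weights form an arithmetic progression, so the two neighbours of a
    weight add up to twice it. At [n = 0] the sign in [prev] matches the weight -1 of index -1. *)
Lemma sum_n_odd_wt_neighbours (u : nat -> C) (K : nat) :
  sum_n (fun n => odd_wt n * (prev u n + u (S n)))%C K
  = (2 * sum_n (fun n => odd_wt n * u n) K + odd_wt K * u (S K) - odd_wt (S K) * u K)%C :> C.
Proof.
  induction K as [|K IH].
  - rewrite !sum_n_0_C, odd_wt_S, odd_wt_0. unfold prev; ring.
  - rewrite !sum_n_S_C, IH, !odd_wt_S. unfold prev; ring.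
Qed.

(** The derivative of the finite product at [x = 1]. In the recursion,
    [(1 + q^(2M)) - 2 q^M = (1 - q^M)^2] supplies the new factor, and the boundary terms vanish
    because [K] is beyond the support. *)
Lemma sum_n_odd_wt_bcoef (q : C) (N K : nat) : (N <= K)%nat ->
  sum_n (fun n => odd_wt n * bcoef q N n)%C K = (qpoch q N ^ 2)%C :> C.
Proof.
  intros HK; revert K HK; induction N as [|N IH]; intros K HK.
  - induction K as [|K IHK].
    + rewrite sum_n_0_C, odd_wt_0; simpl; ring.
    + rewrite sum_n_S_C, IHK by lia. simpl; ring.
  - rewrite (sum_n_ext_C _ (fun n => (1 + q ^ (2 * S N)) * (odd_wt n * bcoef q N n)
      + - q ^ S N * (odd_wt n * (prev (bcoef q N) n + bcoef q N (S n))))%C).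
    + rewrite sum_n_plus_C, !sum_n_scal_C, sum_n_odd_wt_neighbours, IH by lia.
      rewrite !(bcoef_gt q N) by lia. cbn [qpoch].
      replace (2 * S N)%nat with (S N + S N)%nat by lia. rewrite Cpow_add_r. ring.
    + intros n _. rewrite bcoef_S. ring.
Qed.

(* [(-1)^n q^(n(n+1)/2)] *)
Fixpoint signed_tri (q : C) (n : nat) : C :=
  match n with O => 1%C | S k => (- q ^ S k * signed_tri q k)%C end.

(** The finite triple product: the coefficient is [signed_tri q n] times a quotient of q-factorials
    of q-binomial type. Denominators are multiplied out, and [k = N - n] avoids subtraction. *)
Lemma bcoef_closed (q : C) (k n : nat) : q <> 0%C ->
  (bcoef q (n + k) n * qpoch q k * qpoch q (S (2 * n + k)))%C
  = (signed_tri q n * qpoch q (S (2 * (n + k))))%C.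
Proof.
  intros Hq. remember (n + k)%nat as N eqn:HN. revert k n HN.
  induction N as [|N IH]; intros k n HN.
  - assert (n = 0)%nat by lia; assert (k = 0)%nat by lia; subst; simpl; ring.
  - set (W := qpoch q (S (2 * N))).
    (* The left neighbour with its power of [q] normalised, in a form that also holds at [n = 0],
       where [prev] reflects to index 0. *)
    assert (E0 : (- q ^ n * prev (bcoef q N) n * qpoch q k * qpoch q (N + n))%C = (signed_tri q n * W)%C).
    { destruct n as [|n]; unfold prev.
      - specialize (IH N 0%nat eq_refl). simpl (2 * 0 + N)%nat in IH.
        rewrite Nat.add_0_r. replace k with (S N) by lia.
        simpl (q ^ 0)%C. cbn [signed_tri] in *. fold W in IH.
        transitivity (bcoef q N 0 * qpoch q N * qpoch q (S N))%C; [ring|exact IH].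
      - specialize (IH k n ltac:(lia)). fold W in IH.
        replace (N + S n)%nat with (S (2 * n + k)) by lia.
        transitivity (- q ^ S n * (bcoef q N n * qpoch q k * qpoch q (S (2 * n + k))))%C; [ring|].
        rewrite IH. cbn [signed_tri]. ring. }
    assert (QN : forall m, (qpoch q (S m) = qpoch q m * (1 - q ^ S m))%C) by reflexivity.
    replace (S (2 * n + k)) with (S (S (N + n))) by lia.
    replace (S (2 * S N)) with (S (S (S (2 * N)))) by lia.
    rewrite bcoef_S. rewrite (QN (S (S (2 * N)))), (QN (S (2 * N))). fold W.
    (* For [k = 0] the index is the new top one, and only the left neighbour contributes. *)
    destruct k as [|k].
    + rewrite (bcoef_gt q N n), (bcoef_gt q N (S n)) by lia.
      assert (n = S N) by lia; subst n.
      rewrite (QN (S (N + S N))), (QN (N + S N)%nat).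
      transitivity (- q ^ S N * prev (bcoef q N) (S N) * qpoch q 0 * qpoch q (N + S N)
         * (1 - q ^ S (N + S N)) * (1 - q ^ S (S (N + S N))))%C; [ring|].
      rewrite E0.
      replace (S (S (S (2 * N)))) with (S (S (N + S N))) by lia.
      replace (S (S (2 * N))) with (S (N + S N)) by lia. ring.
    + assert (HNk : N = (n + k)%nat) by lia.
      assert (E1 : (bcoef q N n * qpoch q k * qpoch q (S (N + n)))%C = (signed_tri q n * W)%C).
      { pose proof (IH k n HNk) as I1; fold W in I1. rewrite <- I1. do 2 f_equal; lia. }
      (* The factor [1 - q^k] is 0 at [k = 0], exactly where the right neighbour leaves the
         support. *)
      assert (E2 : (bcoef q N (S n) * qpoch q (S k) * qpoch q (S (S (N + n))))%C
                   = (- q ^ S n * signed_tri q n * W * (1 - q ^ S k) * (1 - q ^ k))%C).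
      { destruct k as [|k].
        - rewrite bcoef_gt by lia. simpl (q ^ 0)%C; ring.
        - pose proof (IH k (S n) ltac:(lia)) as I2. fold W in I2.
          replace (S (2 * S n + k)) with (S (S (N + n))) in I2 by lia.
          rewrite (QN (S k)), (QN k).
          transitivity (bcoef q N (S n) * qpoch q k * qpoch q (S (S (N + n)))
            * (1 - q ^ S k) * (1 - q ^ S (S k)))%C; [ring|]. rewrite I2. cbn [signed_tri]. ring. }
      transitivity ((1 + q ^ (2 * S N)) * (bcoef q N n * qpoch q k * qpoch q (S (N + n)))
          * (1 - q ^ S k) * (1 - q ^ S (S (N + n)))
        + q ^ S k * (- q ^ n * prev (bcoef q N) n * qpoch q (S k) * qpoch q (N + n))
          * (1 - q ^ S (N + n)) * (1 - q ^ S (S (N + n)))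
        - q ^ S N * (bcoef q N (S n) * qpoch q (S k) * qpoch q (S (S (N + n)))))%C.
      * rewrite (QN k), (QN (S (N + n))), (QN (N + n)%nat). subst N.
        replace (q ^ S (n + k))%C with (q ^ S k * q ^ n)%C
          by (rewrite <- Cpow_add_r; f_equal; lia). ring.
      * rewrite E0, E1, E2. subst N.
        replace (2 * S (n + k))%nat with (n + n + k + k + 2)%nat by lia.
        replace (S (S (S (2 * (n + k)))))%nat with (n + n + k + k + 3)%nat by lia.
        replace (S (S (2 * (n + k))))%nat with (n + n + k + k + 2)%nat by lia.
        replace (S (S (n + k + n)))%nat with (n + n + k + 2)%nat by lia.
        replace (S (n + k + n))%nat with (n + n + k + 1)%nat by lia.
        replace (S (n + k))%nat with (n + k + 1)%nat by lia.
        replace (S k) with (k + 1)%nat by lia. replace (S n) with (n + 1)%nat by lia.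
        rewrite !Cpow_add_r. ring.
Qed.

Lemma half_shift_nat (n : nat) : half_shift (Z.of_nat n) = INR n + / 2.
Proof. unfold half_shift; rewrite <- INR_IZR_INZ; reflexivity. Qed.

Lemma half_shift_neg (n : nat) : half_shift (- Z.of_nat n - 1) = - (INR n + / 2).
Proof. unfold half_shift; rewrite minus_IZR, opp_IZR, <- INR_IZR_INZ; field. Qed.

Lemma ee_quarter : ee (RtoC (/ 4)) = Ci.
Proof.
  rewrite ee_real; replace (2 * PI * / 4) with (PI / 2) by field.
  rewrite cos_PI2, sin_PI2; reflexivity.
Qed.

Lemma quarter_C : RtoC (/ 4) = (/ 4)%C.
Proof. apply RtoC_inv; lra. Qed.

Lemma theta_term_0 (tau : C) (n : nat) :
  theta_term tau (Z.of_nat n) 0 = (Ci * (ee (tau / 8) * signed_tri (ee tau) n))%C.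
Proof.
  unfold theta_term; rewrite half_shift_nat.
  induction n as [|n IH].
  - simpl INR. rewrite <- ee_quarter; cbn [signed_tri]. rewrite Cmult_1_r, <- ee_plus.
    f_equal. rewrite Rplus_0_l. pushC. rewrite quarter_C. field.
  - cbn [signed_tri]. rewrite S_INR.
    transitivity (ee (RtoC (/ 2)) * ee (RtoC (INR (S n)) * tau) *
      ee (RtoC (/ 2 * (INR n + / 2) ^ 2) * tau + RtoC (INR n + / 2) * (0 + RtoC (/ 2))))%C.
    + rewrite <- !ee_plus; f_equal. rewrite S_INR. pushC. field.
    + rewrite IH, ee_half, ee_nat_mul. ring.
Qed.

(** Oddness at [z = 0]: the terms of [n] and [-n-1] cancel. In the derivative the weight
    [half_shift] changes sign as well, so there they add up. *)
Lemma theta_term_0_neg (tau : C) (n : nat) :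
  theta_term tau (- Z.of_nat n - 1) 0 = (- theta_term tau (Z.of_nat n) 0)%C.
Proof.
  unfold theta_term; rewrite half_shift_neg, half_shift_nat.
  transitivity (ee (RtoC (/ 2)) * ee (RtoC (/ 2 * (INR n + / 2) ^ 2) * tau
                  + RtoC (INR n + / 2) * (0 + RtoC (/ 2))))%C; [|rewrite ee_half; ring].
  rewrite <- ee_plus. apply ee_eq_mod_Z with (- Z.of_nat n - 1)%Z.
  rewrite minus_IZR, opp_IZR, <- INR_IZR_INZ. pushC. field.
Qed.

Definition jterm (q : C) (n : nat) : C := (odd_wt n * signed_tri q n)%C.

Lemma jtheta'_term (tau : C) (n : nat) :
  (RtoC (2 * PI) * Ci * (half_shift (Z.of_nat n) * theta_term tau (Z.of_nat n) 0))%C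
  = (- RtoC PI * ee (tau / 8) * jterm (ee tau) n)%C.
Proof.
  rewrite theta_term_0, half_shift_nat. unfold jterm, odd_wt.
  replace (RtoC (2 * INR n + 1)) with (2 * RtoC (INR n + / 2))%C
    by (rewrite <- RtoC_mult; f_equal; field).
  rewrite RtoC_mult.
  transitivity
    (Ci * Ci * (2 * PI * (RtoC (INR n + / 2) * (ee (tau / 8) * signed_tri (ee tau) n))))%C; [ring|].
  replace (Ci * Ci)%C with (- (1))%C by (apply C_ext; simpl; ring). ring.
Qed.

Lemma jtheta'_term_neg (tau : C) (n : nat) :
  (RtoC (2 * PI) * Ci * (half_shift (- Z.of_nat n - 1) * theta_term tau (- Z.of_nat n - 1) 0))%C
  = (- RtoC PI * ee (tau / 8) * jterm (ee tau) n)%C.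
Proof.
  rewrite <- jtheta'_term, theta_term_0_neg, half_shift_neg, half_shift_nat, RtoC_opp. ring.
Qed.

Lemma pi_ee_neq_0 (z : C) : (- RtoC PI * ee z)%C <> 0%C.
Proof.
  apply Cmult_neq_0; [|apply ee_neq_0]. rewrite <- RtoC_opp. intros E; apply RtoC_inj in E.
  pose proof PI_RGT_0; lra.
Qed.

(** Up to a nonzero constant [jterm] is a term of the differentiated theta series at 0, whose
    Gaussian bound is already known. *)
Lemma jterm_geometric (tau : C) : upper_half tau ->
  exists M, forall n, Cmod (jterm (ee tau) n) <= M * (/ 2) ^ n.
Proof.
  intros Ht. destruct (gauss_bound (Im tau) (4 * PI * 0 + 4 * PI) Ht) as (K & _ & HK).
  pose proof (pi_ee_neq_0 (tau / 8)) as P. apply Cmod_gt_0 in P.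
  exists (/ Cmod (- RtoC PI * ee (tau / 8)) * K); intros n.
  destruct (theta_term_differential tau 0 0 (Z.of_nat n) 0) as (_ & H & _);
    try (rewrite Cmod_0; lra).
  rewrite jtheta'_term, Cmod_mult in H.
  apply Rmult_le_reg_l with (Cmod (- RtoC PI * ee (tau / 8))); [exact P|].
  rewrite <- !Rmult_assoc, Rinv_r, Rmult_1_l by lra.
  eapply Rle_trans; [exact H|apply HK].
Qed.

Lemma Cmod_ee_lt_1 (tau : C) : upper_half tau -> Cmod (ee tau) < 1.
Proof.
  intros Ht; rewrite Cmod_ee, <- exp_0. apply exp_increasing.
  unfold upper_half in Ht. pose proof PI_RGT_0. nra.
Qed.

(** Jacobi's series for the cube of the Euler product: in the finite identity the coefficient is
    [signed_tri q n * w N n], where [w N n] tends to [1 / P] for fixed [n]. *)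
Lemma jacobi_cube (tau : C) : upper_half tau ->
  Ccv (sum_n (jterm (ee tau))) (limC (qpoch (ee tau)) ^ 3)%C.
Proof.
  intros Ht. set (q := ee tau).
  assert (Hq : Cmod q < 1) by apply (Cmod_ee_lt_1 tau Ht).
  destruct (qpoch_Ccv q Hq) as [HP P0]. set (P := limC (qpoch q)) in *.
  destruct (jterm_geometric tau Ht) as [M HM]. fold q in HM.
  (* For [n > N] the truncated difference [N - n] is 0, so [w] stays bounded for all [N] and [n], as
     [tannery] requires; the link with [bcoef] is claimed for [n <= N] only. *)
  set (w := fun N n => (qpoch q (S (2 * N)) * (/ qpoch q (N - n) * / qpoch q (S (N + n))))%C).
  assert (Ew : forall N n, (n <= N)%nat -> bcoef q N n = (signed_tri q n * w N n)%C).
  { intros N n Hn. pose proof (bcoef_closed q (N - n) n (ee_neq_0 tau)) as E.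
    replace (n + (N - n))%nat with N in E by lia.
    replace (S (2 * n + (N - n))) with (S (N + n)) in E by lia.
    pose proof (qpoch_neq_0 q (N - n) Hq). pose proof (qpoch_neq_0 q (S (N + n)) Hq).
    unfold w. transitivity (bcoef q N n * qpoch q (N - n) * qpoch q (S (N + n))
       * (/ qpoch q (N - n) * / qpoch q (S (N + n))))%C; [field; auto|]. rewrite E; ring. }
  set (U := exp (/ (1 - Cmod q))). set (D := exp (- (/ (1 - Cmod q) * / (1 - Cmod q)))).
  assert (PD : 0 < D) by apply exp_pos.
  assert (HU : forall n, Cmod (qpoch q n) <= U) by (intros; apply Cmod_qpoch_le, Hq).
  assert (HD : forall n, D <= Cmod (qpoch q n)) by (intros; apply Cmod_qpoch_ge, Hq).
  assert (HI : forall n, Cmod (/ qpoch q n) <= / D).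
  { intros n; rewrite Cmod_inv by (apply qpoch_neq_0, Hq). apply Rinv_le_contravar; auto. }
  assert (Cw : forall n, Ccv (fun N => w N n) (/ P)%C).
  { intros n. replace (/ P)%C with (P * (/ P * / P))%C by (field; auto).
    apply Ccv_mult with U; [intros; apply HU| |].
    - apply (Ccv_subseq (qpoch q) P (fun N => S (2 * N)) HP). intros K; exists K; intros; lia.
    - apply Ccv_mult with (/ D); [intros; apply HI| |].
      + apply (Ccv_inv (fun N => qpoch q (N - n)) P D PD); auto.
        apply (Ccv_subseq (qpoch q) P (fun N => (N - n)%nat) HP).
        intros K; exists (K + n)%nat; intros; lia.
      + apply (Ccv_inv (fun N => qpoch q (S (N + n))) P D PD); auto.
        apply (Ccv_subseq (qpoch q) P (fun N => S (N + n)) HP).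
        intros K; exists K; intros; lia. }
  set (B := U * (/ D * / D) + Cmod (/ P)).
  assert (Bw : forall N n, Cmod (w N n - / P) <= B).
  { intros N n; unfold Cminus. apply Cmod_plus_le; [|rewrite Cmod_opp; apply Rle_refl].
    apply Cmod_mult_le; [apply HU|apply Cmod_mult_le; apply HI]. }
  assert (Tn : Ccv (fun N => sum_n (fun n => jterm q n * (w N n - / P)) N)%C 0).
  { apply (tannery (fun N n => jterm q n * (w N n - / P))%C (M * B)).
    - intros N n. replace (M * B * (/ 2) ^ n) with (M * (/ 2) ^ n * B) by ring.
      apply Cmod_mult_le; auto.
    - intros n. replace (RtoC 0) with (jterm q n * (/ P + - / P))%C by ring.
      apply Ccv_scal. apply Ccv_plus; [apply Cw|apply Ccv_const]. }
  assert (Sq : Ccv (fun N => qpoch q N ^ 2)%C (P * P)%C).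
  { apply (Ccv_ext (fun N => qpoch q N * qpoch q N)%C); [intros; simpl; ring|].
    apply Ccv_mult with U; auto. }
  (* The partial sum of [jterm] is [P] times its sum with weight [1 / P], that is, the finite
     identity minus the error with weight [w - 1 / P]. *)
  assert (Fin : Ccv (fun N => P * (qpoch q N ^ 2 + - (1) * sum_n (fun n => jterm q n * (w N n - / P)) N))%C
                    (P * (P * P + - (1) * 0))%C).
  { apply Ccv_scal, Ccv_plus; [exact Sq|apply Ccv_scal, Tn]. }
  replace (P ^ 3)%C with (P * (P * P + - (1) * 0))%C by (simpl; ring).
  eapply Ccv_ext; [|exact Fin]. intros N; cbv beta.
  rewrite <- (sum_n_odd_wt_bcoef q N N (le_n N)).
  rewrite <- sum_n_scal_C, <- sum_n_plus_C, <- sum_n_scal_C.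
  apply sum_n_ext_C; intros n Hn. rewrite Ew by exact Hn.
  unfold jterm. field. exact P0.
Qed.

(** The two halves of the series agree, which doubles [- PI e(tau / 8)]; and [e(tau / 8)] is the
    cube of the prefactor [e(tau / 24)] of [eta]. *)
Lemma jtheta'_0 (tau : C) : upper_half tau -> jtheta' tau 0 = (- RtoC (2 * PI) * eta tau ^ 3)%C.
Proof.
  intros Ht.
  assert (L : Ccv (sum_n (fun n => - RtoC PI * ee (tau / 8) * jterm (ee tau) n)%C)
                  (- RtoC PI * ee (tau / 8) * limC (qpoch (ee tau)) ^ 3)%C).
  { eapply Ccv_ext; [|apply Ccv_scal, (jacobi_cube tau Ht)].
    intros n; cbv beta; rewrite <- sum_n_scal_C; reflexivity. }
  unfold jtheta'. rewrite (sumZ_of_Ccv _ _ _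
    (Ccv_ext _ _ _ (fun N => sum_n_ext_C _ _ N (fun n _ => eq_sym (jtheta'_term tau n))) L)
    (Ccv_ext _ _ _ (fun N => sum_n_ext_C _ _ N (fun n _ => eq_sym (jtheta'_term_neg tau n))) L)).
  unfold eta.
  replace (limC (eta_pprod tau)) with (limC (qpoch (ee tau))).
  - replace (ee (tau / 8)) with (ee (tau / 24) ^ 3)%C.
    + rewrite RtoC_mult; simpl; ring.
    + rewrite <- ee_nat_mul; f_equal. simpl INR. rewrite !RtoC_plus. field.
  - symmetry; apply Ccv_limC.
    apply (Ccv_ext (qpoch (ee tau))); [intros; symmetry; apply eta_pprod_qpoch|].
    apply qpoch_Ccv, Cmod_ee_lt_1, Ht.
Qed.

Lemma eta_neq_0 (tau : C) : upper_half tau -> eta tau <> 0%C.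
Proof.
  intros Ht; unfold eta. apply Cmult_neq_0; [apply ee_neq_0|].
  destruct (qpoch_Ccv (ee tau) (Cmod_ee_lt_1 tau Ht)) as [H1 H2].
  rewrite (Ccv_limC _ (limC (qpoch (ee tau)))); [exact H2|].
  apply (Ccv_ext (qpoch (ee tau))); [intros; symmetry; apply eta_pprod_qpoch|exact H1].
Qed.

(** * Modular transformation *)

Lemma automorphy_neq_0 (a b c d : Z) (tau : C) : upper_half tau -> (a * d - b * c = 1)%Z ->
  (IZR c * tau + IZR d)%C <> 0%C.
Proof.
  unfold upper_half; intros Ht Hd E; destruct tau as [x y]; simpl in Ht.
  pose proof (f_equal Re E) as E1; pose proof (f_equal Im E) as E2; simpl in E1, E2.
  assert (c0 : IZR c = 0) by nra. assert (d0 : IZR d = 0) by nra.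
  apply eq_IZR in c0, d0; subst; lia.
Qed.

Lemma upper_half_moeb (a b c d : Z) (tau : C) : upper_half tau -> (a * d - b * c = 1)%Z ->
  upper_half (moeb a b c d tau).
Proof.
  intros Ht Hd; pose proof (automorphy_neq_0 a b c d tau Ht Hd) as N.
  apply Cmod_gt_0 in N; unfold Cmod in N.
  unfold upper_half, moeb in *; destruct tau as [x y]; simpl in *.
  set (a' := IZR a) in *; set (b' := IZR b) in *; set (c' := IZR c) in *; set (d' := IZR d) in *.
  assert (Dt : a' * d' - b' * c' = 1).
  { unfold a', b', c', d'. rewrite <- !mult_IZR, <- minus_IZR, Hd; reflexivity. }
  match type of N with 0 < sqrt ?s => set (S := s) in * end.
  assert (PS : 0 < S) by (destruct (Rlt_le_dec 0 S); [auto|rewrite sqrt_neg_0 in N by auto; lra]).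
  match goal with |- 0 < ?g => replace g with (y * (a' * d' - b' * c') / S) end.
  - rewrite Dt, Rmult_1_r. apply Rdiv_lt_0_compat; auto.
  - unfold S in *. field. lra.
Qed.

Lemma cdiff_zero (F F' : C -> C) (z : C) : cdiff F F' -> (forall w, F w = 0%C) -> F' z = 0%C.
Proof.
  intros D H. destruct (D (Cmod z + 1)) as [M HM]. apply Cmod_eq_0.
  destruct (Rle_lt_or_eq_dec 0 (Cmod (F' z)) (Cmod_ge_0 _)) as [P|P]; [exfalso|auto].
  pose proof (Cmod_ge_0 z).
  assert (M0 : 0 <= M).
  { destruct (HM z 0%C) as (A1 & _); [lra|rewrite Cmod_0; lra|].
    pose proof (Cmod_ge_0 (F z)); lra. }
  (* For zero [F] the remainder bound reads [h |F' z| <= M h^2]; this [h] is small enough to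
     contradict it. *)
  set (h := Rmin 1 (Cmod (F' z) / (2 * (M + 1)))).
  assert (Ph : 0 < h) by (apply Rmin_pos; [lra|apply Rdiv_lt_0_compat; lra]).
  assert (H1 : h <= 1) by apply Rmin_l.
  assert (H2 : h * (2 * (M + 1)) <= Cmod (F' z)).
  { apply Rle_trans with (Cmod (F' z) / (2 * (M + 1)) * (2 * (M + 1))).
    - apply Rmult_le_compat_r; [lra|apply Rmin_r].
    - right; field; lra. }
  assert (Ch : Cmod h = h) by (rewrite Cmod_R; apply Rabs_pos_eq; lra).
  destruct (HM z h) as (_ & _ & A3); [lra|rewrite Ch; lra|].
  rewrite !H, Ch in A3. replace (0 - 0 - h * F' z)%C with (- (h * F' z))%C in A3 by ring.
  rewrite Cmod_opp, Cmod_mult, Ch in A3. nra.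
Qed.

Definition half_coef (F : C -> C) : C := Cint (fun x => F x * ee (RtoC (- / 2) * x))%C.

(** With [f] and [g] the half-integral coefficients of [F] and [G], the combination [g F - f G] has
    coefficient 0 and vanishes. If [g] were 0, [G] would vanish together with [G' 0]. The factor is
    expressed by derivatives because the functions of interest are 0 at 0. *)
Lemma quasiperiodic_proportional (tau : C) (F F' G G' : C -> C) :
  cdiff F F' -> cdiff G G' ->
  (forall z, F (z + 1)%C = (- F z)%C) -> (forall z, G (z + 1)%C = (- G z)%C) ->
  (forall z, F (z + tau)%C = (- (ee (- (tau * RtoC (/ 2)) - z) * F z))%C) ->
  (forall z, G (z + tau)%C = (- (ee (- (tau * RtoC (/ 2)) - z) * G z))%C) ->
  G' 0%C <> 0%C ->
  forall z, (F z * G' 0)%C = (F' 0 * G z)%C.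
Proof.
  intros DF DG F1 G1 Ft Gt N z.
  set (f := half_coef F). set (g := half_coef G).
  assert (g0 : g <> 0%C).
  { intros g0; apply N, (cdiff_zero G G' _ DG).
    apply (quasiperiodic_zero tau G G' DG G1 Gt g0). }
  assert (DH := cdiff_plus _ _ _ _ (cdiff_scal g _ _ DF) (cdiff_scal (- f) _ _ DG)).
  cbv beta in DH.
  assert (CF := cdiff_ccont_0 _ _ DF). assert (CG := cdiff_ccont_0 _ _ DG).
  assert (H0 : forall z, (g * F z + - f * G z)%C = 0%C).
  { apply (quasiperiodic_zero tau _ _ DH).
    - intros w; rewrite F1, G1; ring.
    - intros w; rewrite Ft, Gt; ring.
    - rewrite (Cint_ext _ (fun x => g * (F x * ee (RtoC (- / 2) * x))
                                + - f * (G x * ee (RtoC (- / 2) * x)))%C) by (intros; ring).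
      assert (CF' : ccont (fun x => F x * ee (RtoC (- / 2) * x))%C)
        by (apply ccont_mult; [exact CF|apply ccont_ee]).
      assert (CG' : ccont (fun x => G x * ee (RtoC (- / 2) * x))%C)
        by (apply ccont_mult; [exact CG|apply ccont_ee]).
      rewrite Cint_plus by (apply ccont_scal; assumption).
      rewrite !Cint_scal by assumption.
      change (g * f + - f * g = 0)%C. ring. }
  assert (H1 := cdiff_zero _ _ 0%C DH H0). cbv beta in H1. specialize (H0 z).
  transitivity (/ g * (g * F z + - f * G z + f * G z) * G' 0)%C; [field; exact g0|].
  rewrite H0.
  transitivity (/ g * (g * F' 0 + - f * G' 0 + f * G' 0) * G z)%C; [|field; exact g0].
  rewrite H1; ring.
Qed.

(** The number [x v + x - v - 1 = (x - 1) (v + 1)] is even unless [x] and [v] are both even, which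
    the determinant excludes. *)
Lemma det_half_odd (x y u v : Z) : (x * u - y * v = 1)%Z -> exists k, (x * v + x - v = 2 * k + 1)%Z.
Proof.
  intros H; apply Z.odd_spec.
  apply (f_equal Z.odd) in H. rewrite Z.odd_sub, !Z.odd_mul in H.
  rewrite Z.odd_sub, Z.odd_add, !Z.odd_mul.
  destruct (Z.odd x), (Z.odd y), (Z.odd u), (Z.odd v); simpl in *; congruence.
Qed.

Lemma C_det (a b c d : Z) : (a * d - b * c = 1)%Z ->
  (RtoC (IZR a) * RtoC (IZR d) - RtoC (IZR b) * RtoC (IZR c))%C = 1%C.
Proof. intros H; rewrite <- !RtoC_mult, <- RtoC_minus, <- !mult_IZR, <- minus_IZR, H; reflexivity. Qed.

Lemma jtheta_moeb (a b c d : Z) (tau z : C) : upper_half tau -> (a * d - b * c = 1)%Z ->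
  let v := (IZR c * tau + IZR d)%C in
  let tau' := moeb a b c d tau in
  (ee (- (IZR c * / v * / 2) * (z * z)) * jtheta tau' (/ v * z) * jtheta' tau 0)%C
  = (/ v * jtheta' tau' 0 * jtheta tau z)%C.
Proof.
  intros Ht Hdet v tau'.
  assert (Ht' : upper_half tau') by (apply upper_half_moeb; auto).
  assert (Nv : v <> 0%C) by (apply (automorphy_neq_0 a b c d); auto).
  set (w := (/ v)%C).
  set (A := RtoC (IZR a)) in *; set (B := RtoC (IZR b)) in *;
    set (Cc := RtoC (IZR c)) in *; set (D := RtoC (IZR d)) in *.
  assert (Dt : (A * D - B * Cc)%C = 1%C) by (apply C_det; auto).
  assert (Etau' : tau' = ((A * tau + B) * w)%C) by reflexivity.
  assert (R0 : (w * v)%C = 1%C) by (unfold w; field; auto).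
  assert (R1 : w = (A - Cc * tau')%C).
  { rewrite Etau'. transitivity (A * (w * v) - Cc * ((A * tau + B) * w))%C; [|rewrite R0; ring].
    transitivity ((A * D - B * Cc) * w)%C; [rewrite Dt; ring|unfold v; ring]. }
  assert (R2 : (tau * w)%C = (D * tau' - B)%C).
  { rewrite Etau'. transitivity (D * ((A * tau + B) * w) - B * (w * v))%C; [|rewrite R0; ring].
    transitivity ((A * D - B * Cc) * (tau * w))%C; [rewrite Dt; ring|unfold v; ring]. }
  (* This coefficient makes the exponent linear in [z] cancel under [z -> z + 1], where the argument
     of theta moves by [a - c tau']. *)
  set (al := (- (Cc * w * / 2))%C).
  set (phi := fun z => (ee (al * (z * z)) * jtheta tau' (w * z))%C).
  assert (Dphi := cdiff_mult _ _ _ _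
    (cdiff_ee _ _ (cdiff_scal al _ _ (cdiff_mult _ _ _ _ cdiff_id cdiff_id)))
    (cdiff_dilate w _ _ (cdiff_jtheta tau' Ht'))). cbv beta in Dphi. fold phi in Dphi.
  destruct (det_half_odd a b d c Hdet) as [k1 Hk1].
  destruct (det_half_odd d c a b) as [k2 Hk2]; [lia|].
  assert (P1 : forall z, phi (z + 1)%C = (- phi z)%C).
  { intros y; unfold phi.
    replace (w * (y + 1))%C with (w * y + RtoC (IZR a) + RtoC (IZR (- c)) * tau')%C
      by (rewrite opp_IZR, RtoC_opp, R1; unfold A, Cc; ring).
    rewrite jtheta_plus_Z_tau, jtheta_plus_Z by auto.
    transitivity (ee (RtoC (/ 2)) * (ee (al * (y * y)) * jtheta tau' (w * y)))%C; [|rewrite ee_half; ring].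
    rewrite !Cmult_assoc, <- !ee_plus. f_equal. apply ee_eq_mod_Z with k1.
    rewrite opp_IZR, RtoC_opp, half_C. fold A Cc.
    replace (RtoC (IZR k1)) with ((A * Cc + A - Cc - 1) * / 2)%C.
    - unfold al. rewrite R1. field.
    - unfold A, Cc. rewrite <- RtoC_mult, <- RtoC_plus, <- RtoC_minus, <- mult_IZR, <- plus_IZR,
        <- minus_IZR, Hk1, plus_IZR, mult_IZR, RtoC_plus, RtoC_mult. field. }
  assert (Pt : forall z, phi (z + tau)%C = (- (ee (- (tau * RtoC (/ 2)) - z) * phi z))%C).
  { intros y; unfold phi.
    replace (w * (y + tau))%C with (w * y + RtoC (IZR (- b)) + RtoC (IZR d) * tau')%C
      by (rewrite opp_IZR, RtoC_opp; fold B D;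
          transitivity (w * y + tau * w)%C; [rewrite R2; ring|ring]).
    rewrite jtheta_plus_Z_tau, jtheta_plus_Z by auto.
    transitivity (ee (RtoC (/ 2)) * (ee (- (tau * RtoC (/ 2)) - y)
      * (ee (al * (y * y)) * jtheta tau' (w * y))))%C;
      [|rewrite ee_half; ring].
    rewrite !Cmult_assoc, <- !ee_plus. f_equal. apply ee_eq_mod_Z with k2.
    rewrite opp_IZR, RtoC_opp, half_C. fold B D.
    replace (RtoC (IZR k2)) with ((D * B + D - B - 1) * / 2)%C.
    - unfold al.
      (* The two added terms are multiples of [1 - w v] and [tau w - (d tau' - b)], both 0; with
         them the identity holds for independent variables. *)
      match goal with |- _ = ?r =>
        transitivity (r + (y + tau * / 2) * (1 - w * v) + D * / 2 * (tau * w - (D * tau' - B)))%C end.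
      + unfold v. fold Cc D. field.
      + rewrite R0, R2. ring.
    - unfold B, D. rewrite <- RtoC_mult, <- RtoC_plus, <- RtoC_minus, <- mult_IZR, <- plus_IZR,
        <- minus_IZR, Hk2, plus_IZR, mult_IZR, RtoC_plus, RtoC_mult. field. }
  pose proof (quasiperiodic_proportional tau _ _ _ _ Dphi (cdiff_jtheta tau Ht) P1
    (fun z => jtheta_plus_1 tau z Ht) Pt (fun z => jtheta_plus_tau tau z Ht)) as Q.
  rewrite (jtheta'_0 tau Ht) in Q at 1.
  (* Jacobi's formula and the absence of zeros of [eta] make the derivative at 0 nonzero. *)
  specialize (Q ltac:(apply Cmult_neq_0; [rewrite <- RtoC_opp; intros E; apply RtoC_inj in E;
     pose proof PI_RGT_0; lra|apply Cpow_nz, eta_neq_0, Ht]) z).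
  unfold phi in Q at 1. rewrite Q.
  rewrite !Cmult_0_r, ee_0. ring.
Qed.

(** * Theta functions with characteristics and the character *)

Lemma theta_jtheta (r1 r2 : Q) (tau : C) : upper_half tau ->
  theta r1 r2 tau
  = (ee (RtoC (/ 2 * Q2R r2 ^ 2) * tau + RtoC (- (Q2R r1 * Q2R r2) + Q2R r2 * / 2))
     * jtheta tau (RtoC (Q2R r2) * tau - RtoC (Q2R r1)))%C.
Proof.
  intros Ht. destruct (geomZ_theta_term tau (RtoC (Q2R r2) * tau - RtoC (Q2R r1)) Ht) as [M HM].
  unfold jtheta. rewrite <- (sumZ_scal _ _ _ HM). unfold theta. apply sumZ_ext; intros n; cbv zeta.
  unfold theta_term, half_shift. rewrite <- ee_plus. f_equal. pushC. field.
Qed.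

Lemma inGamma_defect (r1 r2 : Q) (a b c d : Z) : inGamma r1 r2 a b c d ->
  exists p q : Z, IZR p = (IZR d - 1) * Q2R r1 - IZR b * Q2R r2 /\
                  IZR q = (IZR a - 1) * Q2R r2 - IZR c * Q2R r1.
Proof.
  intros (Hdet & (k1 & H1) & (k2 & H2)).
  (* [A^-1 r - r = - A^-1 (A r - r)], and [A r - r = (k1, k2)]. *)
  exists (b * k2 - d * k1)%Z, (c * k1 - a * k2)%Z.
  rewrite !minus_IZR, !mult_IZR, <- H1, <- H2.
  assert (Dt : IZR a * IZR d - IZR b * IZR c = 1) by (rewrite <- !mult_IZR, <- minus_IZR, Hdet; auto).
  set (x := Q2R r1); set (y := Q2R r2). split.
  - transitivity ((IZR d - (IZR a * IZR d - IZR b * IZR c)) * x - IZR b * y); [ring|rewrite Dt; ring].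
  - transitivity ((IZR a - (IZR a * IZR d - IZR b * IZR c)) * y - IZR c * x); [ring|rewrite Dt; ring].
Qed.

(* Here [(p, q) = A^-1 r - r]. *)
Lemma chi_defect (r1 r2 : Q) (a b c d p q : Z) : (a * d - b * c = 1)%Z ->
  IZR p = (IZR d - 1) * Q2R r1 - IZR b * Q2R r2 ->
  IZR q = (IZR a - 1) * Q2R r2 - IZR c * Q2R r1 ->
  chi r1 r2 a b c d =
  ee (RtoC (/ 2 * (IZR p * IZR q - IZR p - IZR q + Q2R r1 * IZR q - Q2R r2 * IZR p))).
Proof.
  intros Hdet Hp Hq; unfold chi; cbv zeta. do 2 f_equal. rewrite Hp, Hq.
  assert (Dt : IZR a * IZR d - IZR b * IZR c = 1) by (rewrite <- !mult_IZR, <- minus_IZR, Hdet; auto).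
  set (x := Q2R r1); set (y := Q2R r2).
  match goal with |- _ = ?r =>
    transitivity (r + / 2 * x * y * ((IZR a * IZR d - IZR b * IZR c) - 1)) end.
  - field.
  - rewrite Dt; ring.
Qed.

(** The defects form a cocycle: [(A A')^-1 r - r] is [A'^-1 (p, q) + (p', q')]. Modulo 2 the form
    [p q - p - q] is 0 if [p] and [q] are both even and 1 otherwise, so it is invariant under
    invertible matrices. *)
Lemma chi_mult (r1 r2 : Q) (a b c d a' b' c' d' : Z) :
  inGamma r1 r2 a b c d -> inGamma r1 r2 a' b' c' d' ->
  chi r1 r2 (a * a' + b * c') (a * b' + b * d') (c * a' + d * c') (c * b' + d * d')
  = (chi r1 r2 a b c d * chi r1 r2 a' b' c' d')%C.
Proof.
  intros HA HA'.
  destruct (inGamma_defect _ _ _ _ _ _ HA) as (p & q & Hp & Hq).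
  destruct (inGamma_defect _ _ _ _ _ _ HA') as (p' & q' & Hp' & Hq').
  destruct HA as (Hdet & _), HA' as (Hdet' & (k1 & H1) & (k2 & H2)).
  set (x := Q2R r1) in *; set (y := Q2R r2) in *.
  rewrite (chi_defect r1 r2 a b c d p q), (chi_defect r1 r2 a' b' c' d' p' q') by auto.
  rewrite (chi_defect r1 r2 _ _ _ _ (d' * p - b' * q + p') (- c' * p + a' * q + q')).
  - fold x y. rewrite <- ee_plus.
    assert (Ev : exists n, ((d' * p - b' * q) * (- c' * p + a' * q) - (d' * p - b' * q)
                  - (- c' * p + a' * q) - p * q + p + q = 2 * n)%Z).
    { apply Z.even_spec. pose proof (f_equal Z.even Hdet') as Hd.
      rewrite ?Z.even_add, ?Z.even_sub, ?Z.even_mul, ?Z.even_add, ?Z.even_sub, ?Z.even_mul, ?Z.even_opp in *.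
      destruct (Z.even a'), (Z.even b'), (Z.even c'), (Z.even d'), (Z.even p), (Z.even q);
        simpl in *; congruence. }
    destruct Ev as [n Hn].
    (* [n] is the parity defect; the other summand is the first entry of [A'^-1 (p, q)] times [q'],
       to which the cross terms and the terms linear in [r] reduce. *)
    apply ee_eq_mod_Z with (n + (d' * p - b' * q) * q')%Z.
    rewrite <- !RtoC_plus. f_equal.
    apply (f_equal IZR) in Hn.
    rewrite ?plus_IZR, ?minus_IZR, ?mult_IZR, ?plus_IZR, ?minus_IZR, ?mult_IZR, ?opp_IZR in *.
    assert (Dt : IZR a' * IZR d' - IZR b' * IZR c' = 1)
      by (rewrite <- !mult_IZR, <- minus_IZR, Hdet'; auto).
    (* [K1] and [K2] are the two components of [A' r - r = - A' (p', q')], multiplied by [q] and [p]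
       so that the final step is linear in the monomials. *)
    assert (K1 : IZR q * ((IZR a' - 1) * x + IZR b' * y)
                 = - IZR q * (IZR a' * IZR p' + IZR b' * IZR q')).
    { rewrite Hp', Hq'.
      transitivity (IZR q * ((IZR a' - (IZR a' * IZR d' - IZR b' * IZR c')) * x + IZR b' * y));
        [rewrite Dt; ring|ring]. }
    assert (K2 : IZR p * (IZR c' * x + (IZR d' - 1) * y)
                 = - IZR p * (IZR c' * IZR p' + IZR d' * IZR q')).
    { rewrite Hp', Hq'.
      transitivity (IZR p * (IZR c' * x + (IZR d' - (IZR a' * IZR d' - IZR b' * IZR c')) * y));
        [rewrite Dt; ring|ring]. }
    clear Hp Hq Hp' Hq' Dt H1 H2. lra.
  - transitivity ((a * d - b * c) * (a' * d' - b' * c'))%Z; [ring|rewrite Hdet, Hdet'; ring].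
  - fold x y. rewrite ?plus_IZR, ?minus_IZR, ?mult_IZR, Hp, Hq, Hp'. ring.
  - fold x y. rewrite ?plus_IZR, ?minus_IZR, ?mult_IZR, ?opp_IZR, Hp, Hq, Hq'. ring.
Qed.

Lemma theta_moeb (r1 r2 : Q) (a b c d : Z) (eps : C -> C) (psi : C) :
  inGamma r1 r2 a b c d -> is_mp_eps c d eps ->
  (forall tau, upper_half tau -> eta (moeb a b c d tau) = (psi * eps tau * eta tau)%C) ->
  forall tau, upper_half tau ->
    theta r1 r2 (moeb a b c d tau) = (psi ^ 3 * chi r1 r2 a b c d * eps tau * theta r1 r2 tau)%C.
Proof.
  intros HA [_ Heps] Heta tau Ht.
  destruct (inGamma_defect _ _ _ _ _ _ HA) as (p & q & Hp & Hq). destruct HA as (Hdet & _).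
  specialize (Heps tau Ht). specialize (Heta tau Ht).
  assert (Ht' : upper_half (moeb a b c d tau)) by (apply upper_half_moeb; auto).
  assert (Nv := automorphy_neq_0 a b c d tau Ht Hdet).
  set (x := Q2R r1) in *; set (y := Q2R r2) in *.
  set (tau' := moeb a b c d tau) in *. set (v := (IZR c * tau + IZR d)%C) in *.
  set (z := (v * (RtoC y * tau' - RtoC x))%C).
  pose proof (jtheta_moeb a b c d tau z Ht Hdet) as M. cbv zeta in M. fold v tau' in M.
  rewrite (jtheta'_0 tau Ht), (jtheta'_0 tau' Ht'), Heta in M.
  replace (/ v * z)%C with (RtoC y * tau' - RtoC x)%C in M by (unfold z; field; auto).
  pose proof (eta_neq_0 tau Ht) as Ne.
  assert (N2 : (RtoC (2 * PI)) <> 0%C) by (intros E; apply RtoC_inj in E; pose proof PI_RGT_0; lra).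
  set (X := jtheta tau' (RtoC y * tau' - RtoC x)) in *.
  assert (MX : (ee (- (IZR c * / v * / 2) * (z * z)) * X)%C = (psi ^ 3 * eps tau * jtheta tau z)%C).
  { transitivity (ee (- (IZR c * / v * / 2) * (z * z)) * X * (- RtoC (2 * PI) * eta tau ^ 3)
       * / (- RtoC (2 * PI) * eta tau ^ 3))%C; [field; auto|].
    rewrite M. rewrite <- Heps. field. repeat split; auto.
    intros E; rewrite E in Heps; apply Nv; rewrite <- Heps; ring. }
  assert (X1 : X = (psi ^ 3 * eps tau * (ee (IZR c * / v * / 2 * (z * z)) * jtheta tau z))%C).
  { transitivity (ee (- (IZR c * / v * / 2 * (z * z))) * ee (IZR c * / v * / 2 * (z * z)) * X)%C;
      [rewrite ee_opp; ring|].
    replace (- (IZR c * / v * / 2 * (z * z)))%C with (- (IZR c * / v * / 2) * (z * z))%C by ring.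
    transitivity (ee (IZR c * / v * / 2 * (z * z)) * (ee (- (IZR c * / v * / 2) * (z * z)) * X))%C;
      [ring|rewrite MX; ring]. }
  rewrite !theta_jtheta by auto. fold x y tau' X. rewrite X1.
  set (A := RtoC (IZR a)); set (B := RtoC (IZR b)); set (Cc := RtoC (IZR c)) in *;
    set (D := RtoC (IZR d)).
  assert (Dt : (A * D - B * Cc)%C = 1%C) by (apply C_det; auto).
  assert (R3 : (v * tau')%C = (A * tau + B)%C) by (change tau' with ((A * tau + B) / v)%C; field; auto).
  (* The coordinates of [z] with respect to [tau] and -1 are those of [A^-1 r = r + (p, q)]. *)
  assert (Ez : z = (RtoC y * tau - RtoC x + RtoC (IZR (- p)) + RtoC (IZR q) * tau)%C).
  { unfold z. transitivity (RtoC y * (v * tau') - RtoC x * v)%C; [ring|].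
    rewrite R3, opp_IZR, Hp, Hq. unfold v. pushC. fold A B Cc D. ring. }
  assert (R4 : (tau' * (1 + Cc * (A * tau + B)))%C = (A * (A * tau + B))%C).
  { transitivity (A * (v * tau'))%C; [|rewrite R3; ring].
    transitivity (tau' * ((A * D - B * Cc) + Cc * (A * tau + B)))%C; [rewrite Dt; ring|].
    unfold v; fold Cc D; ring. }
  (* Clearing [1 / v] through [v tau' = a tau + b] leaves a Gaussian exponent polynomial in [tau]
     and [tau']. *)
  assert (R5 : (Cc * / v * / 2 * (z * z))%C
    = (/ 2 * Cc * (RtoC y ^ 2 * tau' * (A * tau + B) - 2 * RtoC x * RtoC y * (A * tau + B)
       + RtoC x ^ 2 * v))%C).
  { transitivity (/ 2 * Cc * (RtoC y ^ 2 * tau' * (v * tau') - 2 * RtoC x * RtoC y * (v * tau')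
       + RtoC x ^ 2 * v))%C; [unfold z; field; auto|rewrite R3; ring]. }
  rewrite (chi_defect r1 r2 a b c d p q) by auto. fold x y.
  rewrite R5, Ez, jtheta_plus_Z_tau, jtheta_plus_Z by auto.
  set (Y := jtheta tau (RtoC y * tau - RtoC x)).
  (* All exponentials on each side are merged. The exponents differ by the integer [q], up to
     multiples of the relation [R4] and of [det A - 1]. *)
  match goal with |- (ee ?e1 * (?k * (ee ?e2 * (ee ?e3 * (ee ?e4 * _)))))%C
                     = (_ * ee ?f1 * _ * (ee ?f2 * _))%C =>
    transitivity (k * ee (e1 + e2 + e3 + e4) * Y)%C;
      [rewrite !ee_plus; ring|transitivity (k * ee (f1 + f2) * Y)%C; [|rewrite !ee_plus; ring]];
    do 2 f_equal; apply ee_eq_mod_Z with q;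
    transitivity (f1 + f2 + RtoC (IZR q) + / 2 * RtoC y ^ 2 *
      (tau' * (1 + Cc * (A * tau + B)) - A * (A * tau + B))
      + / 2 * RtoC x * RtoC y * ((A * D - B * Cc) - 1))%C; [|rewrite R4, Dt; ring]
  end.
  rewrite opp_IZR, Hp, Hq. unfold v. pushC. fold A B Cc D. field.
Qed.

(** [psi] is given by its defining relation, which determines it because [eta] and [eps] have no
    zeros on the half plane. *)
Theorem theorem2p14 (r1 r2 : Q) :
  (forall (a b c d : Z) (eps : C -> C) (psi : C),
      inGamma r1 r2 a b c d ->
      is_mp_eps c d eps ->
      (forall tau, upper_half tau ->
         eta (moeb a b c d tau) = (psi * eps tau * eta tau)%C) ->
      forall tau, upper_half tau ->
        theta r1 r2 (moeb a b c d tau)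
        = (psi ^ 3 * chi r1 r2 a b c d * eps tau * theta r1 r2 tau)%C) /\
  (forall a b c d a' b' c' d' : Z,
      inGamma r1 r2 a b c d -> inGamma r1 r2 a' b' c' d' ->
      chi r1 r2 (a * a' + b * c') (a * b' + b * d') (c * a' + d * c') (c * b' + d * d')
      = (chi r1 r2 a b c d * chi r1 r2 a' b' c' d')%C).
Proof.
  split.
  - apply theta_moeb.
  - intros *; apply chi_mult.
Qed.
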